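(* Let $q\ge 1$ be an integer, $H\in(\tfrac12,1)$, and let the parameters satisfy $a>0$, $b_1\ge 0$, $|b_1|<b_0$, $T_{\mathrm{per}}>0$, $\sigma_0>0$, $\sigma_1\ge 0$, $\varepsilon>0$. Put $b(t)=b_0+b_1\sin(2\pi t/T_{\mathrm{per}})$ and $\tilde\sigma(x)=\sigma_0+\sigma_1\sqrt{\phi_\varepsilon(x)}$. Assume that for every $t$ the map $x\mapsto a(b(t)-x)$ and the map $\tilde\sigma$ belong to $\mathcal C^3_b(\mathbb R)$, and that there is a constant $C>0$ with $\|L^{H,q}_t-L^{H,q}_s\|_{L^2(\mathbb R^q)}\le C|t-s|^H$ for all $s,t\in[0,T]$. Then, for every $T>0$ and $x_0>0$, the stochastic differential equation $$dX_t=a\bigl(b(t)-X_t\bigr)\,dt+\tilde\sigma(X_t)\,dZ^{(q,H)}_t,\qquad X_0=x_0,$$ admits a unique solution $(X_t)_{t\in[0,T]}$ such that, almost surely, $$(X_t)_{t\in[0,T]}\in W_1^\alpha(0,T;\mathbb R)\cap C^{1-\alpha}(0,T;\mathbb R)$$ for every $\alpha\in(1-H,\tfrac12)$.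
   Context: Setting: $(\Omega,\mathcal F,\mathbb P)$ is the classical two-sided Wiener space: $\Omega$ is the space of continuous $\omega:\mathbb R\to\mathbb R$ with $\omega(0)=0$, $\mathbb P$ is two-sided Wiener measure, and $B$ is the canonical two-sided Brownian motion. $I_q(f)$ denotes the $q$-th multiple Wiener–Itô integral with respect to $B$ of a symmetric $f\in L^2(\mathbb R^q)$. Hermite process: for an integer $q\ge1$ and $H\in(\tfrac12,1)$ set $H_0=1+\frac{H-1}{q}$ and $c(H,q)=\sqrt{\frac{H(2H-1)}{q!\,\beta(H_0-\frac12,\,2-2H_0)^q}}$, where $\beta(\cdot,\cdot)$ is the Beta function. The Hermite process is $Z^{(q,H)}_t=I_q(L^{H,q}_t)$, $t\ge0$, with kernel $L^{H,q}_t(\xi_1,\dots,\xi_q)=c(H,q)\int_0^t\prod_{j=1}^q(s-\xi_j)_+^{H_0-3/2}\,ds$, where $\theta_+^{r}=\theta^{r}\mathbf 1_{\theta>0}$. $Z^{(q,H)}$ is taken in a modification whose paths are $\lambda$-Hölder continuous on compacts for every $\lambda<H$. Coefficients: $\phi_\varepsilon:\mathbb R\to(0,\infty)$ is a fixed $\mathcal C^\infty$ function with (a) $\phi_\varepsilon(x)=x+\varepsilon$ for all $x\ge0$; (b) $\phi_\varepsilon(x)>0$ for all $x\in\mathbb R$; (c) all derivatives (of order $\ge1$) of $\phi_\varepsilon$ are bounded. $\mathcal C^3_b(\mathbb R)$ is the space of three times continuously differentiable functions whose derivatives of orders $1,2,3$ are bounded (the functions themselves, e.g. affine ones, need not be bounded).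 The stochastic integral is the pathwise Young–Riemann–Stieltjes integral, i.e. the equation means that, almost surely, $X_t=x_0+\int_0^t a(b(s)-X_s)\,ds+\int_0^t\tilde\sigma(X_s)\,dZ^{(q,H)}_s$ for all $t\in[0,T]$, the last integral being a Young integral for each fixed path. Function spaces: for $\alpha\in(0,\tfrac12)$, $W_1^\alpha(0,T;\mathbb R)$ is the space of measurable $f:[0,T]\to\mathbb R$ with $\sup_{t\in[0,T]}\bigl(|f(t)|+\int_0^t\frac{|f(t)-f(s)|}{|t-s|^{\alpha+1}}\,ds\bigr)<\infty$. $C^{\lambda}(0,T;\mathbb R)$ is the space of $\lambda$-Hölder continuous functions on $[0,T]$. *)

(* Defs.v *)
From HB Require Import structures.
From mathcomp Require Import all_boot all_order all_algebra.
From mathcomp Require Import all_classical all_reals all_analysis.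

Set Implicit Arguments.
Unset Strict Implicit.
Unset Printing Implicit Defensive.

Import Order.TTheory GRing.Theory Num.Theory.
Import numFieldNormedType.Exports.

Local Open Scope classical_set_scope.
Local Open Scope ring_scope.

(** * Two-sided Wiener space *)

Definition wiener_path (R : realType) : Type :=
  {w : R -> R | continuous w /\ w 0 = 0}.

Definition coord (R : realType) (t : R) (w : wiener_path R) : R := sval w t.

Lemma zero_path_subproof (R : realType) :
  continuous (fun _ : R => 0 : R) /\ (fun _ : R => 0 : R) 0 = 0.
Proof. by split => // x; exact: cvg_cst. Qed.

HB.instance Definition _ (R : realType) := gen_eqMixin (wiener_path R).
HB.instance Definition _ (R : realType) := gen_choiceMixin (wiener_path R).
HB.instance Definition _ (R : realType) :=
  isPointed.Build (wiener_path R) (exist _ _ (zero_path_subproof R)).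

Definition cylinders (R : realType) : set (set (wiener_path R)) :=
  [set A | exists (t : R) (U : set R), measurable U /\ A = coord t @^-1` U].

(* The sigma-algebra is the one generated by the canonical process (it is also
   the Borel sigma-algebra for local uniform convergence); no completion. *)
Definition wiener_space (R : realType) : Type :=
  g_sigma_algebraType (@cylinders R).
HB.instance Definition _ (R : realType) := Measurable.on (wiener_space R).

Definition brownian (R : realType) (t : R) (w : wiener_space R) : R := coord t w.

(* Increments over successive intervals of the whole line are independent and
   centred Gaussian with variance the length of the interval; by a pi-lambda
   argument, this determines P on the canonical sigma-algebra.
   The last parameter of [normal_prob] is a standard deviation. *)
Definition two_sided_wiener_measure (R : realType)
    (P : probability (wiener_space R) R) : Prop :=
  forall (n : nat) (t : nat -> R) (A : nat -> set R),
    (forall i, (i < n)%N -> t i < t i.+1) ->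
    (forall i, measurable (A i)) ->
    P [set w | forall i, (i < n)%N -> A i (brownian (t i.+1) w - brownian (t i) w)] =
    (\prod_(i < n) normal_prob 0 (Num.sqrt (t i.+1 - t i)) (A i))%E.

(** * Lebesgue measure on R^n *)

Section lebesgue_tuple.
Variable R : realType.
Local Notation tupleR n := (n.-tuple (measurableTypeR R)).

Definition tuple_cons (n : nat) (p : measurableTypeR R * tupleR n) :
  tupleR n.+1 := [tuple of p.1 :: p.2].

Lemma measurable_tuple_cons (n : nat) :
  measurable_fun [set: measurableTypeR R * tupleR n] (@tuple_cons n).
Proof. exact: measurable_cons. Qed.

Definition lebesgue_cons (n : nat) (m : {measure set (tupleR n) -> \bar R}) :
    set (tupleR n.+1) -> \bar R :=
  pushforward (lebesgue_measure \x^ m)%E (@tuple_cons n).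

HB.instance Definition _ (n : nat) (m : {measure set (tupleR n) -> \bar R}) :=
  Measure.copy (lebesgue_cons m)
    (@measure_function_pushforward__canonical__measure_function_Measure
       _ _ _ _ _ (lebesgue_measure \x^ m)%E _ (@measurable_tuple_cons n)).

Fixpoint lebesgue_tuple (n : nat) : {measure set (tupleR n) -> \bar R} :=
  match n with
  | 0 => dirac ([tuple] : tupleR 0)
  | n'.+1 => lebesgue_cons (lebesgue_tuple n')
  end.

End lebesgue_tuple.

(** * Multiple Wiener-Ito integrals *)

(* Ito's elementary kernels: linear combinations of indicators of boxes
   ]x_{i_1}, x_{i_1 + 1}] * ... * ]x_{i_q}, x_{i_q + 1}], where
   x_0 < ... < x_m, whose coefficients vanish as soon as two of the indices
   i_1, ..., i_q coincide. *)
Record elem_kernel (R : realType) (q : nat) := ElemKernel {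
  ek_size : nat ;
  ek_knot : nat -> R ;
  ek_coef : q.-tuple 'I_ek_size -> R ;
  ek_knot_lt : forall k, (k < ek_size)%N -> ek_knot k < ek_knot k.+1 ;
  ek_offdiag : forall i : q.-tuple 'I_ek_size, ~~ uniq i -> ek_coef i = 0 }.

Definition ek_fun (R : realType) (q : nat) (F : elem_kernel R q)
    (xi : q.-tuple (measurableTypeR R)) : R :=
  \sum_(i : q.-tuple 'I_(ek_size F)) ek_coef i *
    \prod_(j < q)
      \1_(`]ek_knot F (tnth i j), ek_knot F (tnth i j).+1]%classic : set R)
        (tnth xi j).

Definition ek_integral (R : realType) (q : nat) (F : elem_kernel R q)
    (w : wiener_space R) : R :=
  \sum_(i : q.-tuple 'I_(ek_size F)) ek_coef i *
    \prod_(j < q) (brownian (ek_knot F (tnth i j).+1) w -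
                   brownian (ek_knot F (tnth i j)) w).

(* [Y] is a version of I_q(f).  Elementary kernels are dense in L^2(R^q) and
   E[I_q(F)^2] <= q! ||F||^2, so such a Y exists for every f in L^2(R^q) and is
   unique almost surely; E[I_q(f)^2] = q! ||f||^2 for symmetric f. *)
Definition is_multiple_wiener_integral (R : realType)
    (P : probability (wiener_space R) R) (q : nat)
    (f : q.-tuple (measurableTypeR R) -> R) (Y : wiener_space R -> R) : Prop :=
  [/\ measurable_fun [set: q.-tuple (measurableTypeR R)] f,
      measurable_fun [set: wiener_space R] Y &
      exists F : nat -> elem_kernel R q,
        (fun n => Lnorm (lebesgue_tuple R q) 2%:E
                    (EFin \o (ek_fun (F n) \- f))) @ \oo --> 0%E /\
        (fun n => Lnorm P 2%:E
                    (EFin \o (ek_integral (F n) \- Y))) @ \oo --> 0%E].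

(** * Hermite processes *)

(* The library's [beta_fun] only takes natural numbers as arguments. *)
Definition Beta (R : realType) (x y : R) : R :=
  \int[lebesgue_measure]_(u in `]0, 1[) (u `^ (x - 1) * (1 - u) `^ (y - 1)).

Definition pos_powR (R : realType) (theta r : R) : R :=
  if 0 < theta then theta `^ r else 0.

Definition hermite_H0 (R : realType) (q : nat) (H : R) : R :=
  1 + (H - 1) / q%:R.

Definition hermite_const (R : realType) (q : nat) (H : R) : R :=
  let H0 := hermite_H0 q H in
  Num.sqrt (H * (2 * H - 1) / (q`!%:R * Beta (H0 - 2^-1) (2 - 2 * H0) ^+ q)).

(* For q >= 2 the integral diverges when the largest xi_j lies in [0, t[ and is
   attained at least twice, in which case [Rintegral] returns 0; this only
   affects a Lebesgue-null set of points xi. *)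
Definition hermite_kernel (R : realType) (q : nat) (H t : R)
    (xi : q.-tuple (measurableTypeR R)) : R :=
  hermite_const q H *
  \int[lebesgue_measure]_(s in `[0, t])
    \prod_(j < q) pos_powR (s - tnth xi j) (hermite_H0 q H - 3 / 2).

Definition holder_on (R : realType) (lam a b : R) (f : R -> R) : Prop :=
  exists C : R, forall s t, s \in `[a, b] -> t \in `[a, b] ->
    `|f t - f s| <= C * `|t - s| `^ lam.

Definition hermite_process (R : realType) (P : probability (wiener_space R) R)
    (q : nat) (H : R) (Z : R -> wiener_space R -> R) : Prop :=
  (forall t, 0 <= t ->
     is_multiple_wiener_integral P (@hermite_kernel R q H t) (Z t)) /\
  (forall w lam K, 0 < lam -> lam < H -> 0 <= K ->
     holder_on lam 0 K (Z ^~ w)).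

(** * Coefficients *)

Definition C3b (R : realType) (f : R -> R) : Prop :=
  [/\ forall (n : nat) (x : R), (n < 3)%N -> derivable (f^`(n))%classic x 1,
      continuous (f^`(3))%classic &
      forall n : nat, (1 <= n <= 3)%N ->
        exists M : R, forall x, `|(f^`(n))%classic x| <= M].

Definition regularized_positive_part (R : realType) (eps : R) (phi : R -> R) :
    Prop :=
  [/\ forall (n : nat) (x : R), derivable (phi^`(n))%classic x 1,
      forall x, 0 <= x -> phi x = x + eps,
      forall x, 0 < phi x &
      forall n : nat, (1 <= n)%N ->
        exists M : R, forall x, `|(phi^`(n))%classic x| <= M].

Definition seasonal_mean (R : realType) (b0 b1 Tper t : R) : R :=
  b0 + b1 * sin (2 * pi * t / Tper).

Definition diffusion (R : realType) (sigma0 sigma1 : R) (phi : R -> R) (x : R) :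
    R :=
  sigma0 + sigma1 * Num.sqrt (phi x).

(** * Pathwise equation *)

Definition riemann_stieltjes_sum (R : realType) (f g : R -> R) (a : R)
    (s : seq R) (tag : nat -> R) : R :=
  \sum_(i < size s) f (tag i) * (g (nth a s i) - g (nth a (a :: s) i)).

(* [I] is the limit of the tagged Riemann-Stieltjes sums over the partitions
   [a :: s] of [a, b] as the mesh tends to 0. *)
Definition is_young_integral (R : realType) (f g : R -> R) (a b I : R) : Prop :=
  forall e : R, 0 < e -> exists2 d : R, 0 < d &
    forall (s : seq R) (tag : nat -> R), itv_partition a b s ->
      (forall i, (i < size s)%N ->
         nth a s i - nth a (a :: s) i < d /\
         nth a (a :: s) i <= tag i <= nth a s i) ->
      `|riemann_stieltjes_sum f g a s tag - I| < e.

(* The processes are indexed by all of R, but only their values on [0, T] are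
   constrained. *)
Definition is_solution (R : realType) (P : probability (wiener_space R) R)
    (Z : R -> wiener_space R -> R) (drift : R -> R -> R) (sigma : R -> R)
    (T x0 : R) (X : R -> wiener_space R -> R) : Prop :=
  (forall t, t \in `[0, T] -> measurable_fun [set: wiener_space R] (X t)) /\
  {ae P, forall w, forall t, t \in `[0, T] ->
    lebesgue_measure.-integrable `[0, t]
      (EFin \o (fun s : measurableTypeR R => drift s (X s w))) /\
    exists2 I : R, is_young_integral (fun s => sigma (X s w)) (Z ^~ w) 0 t I &
      X t w = x0 + \int[lebesgue_measure]_(s in `[0, t]) drift s (X s w) + I}.

(** * Function spaces *)

Definition W1_space (R : realType) (alpha T : R) (f : R -> R) : Prop :=
  measurable_fun (`[0, T]%classic : set (measurableTypeR R)) f /\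
  (ereal_sup [set (`|f t|%:E +
     \int[lebesgue_measure]_(s in `[0%R, t])
       (`|f t - f s| / `|t - s| `^ (alpha + 1))%:E)%E | t in `[0%R, T]]
   < +oo)%E.

Definition holder_space (R : realType) (lam T : R) (f : R -> R) : Prop :=
  holder_on lam 0 T f.

(* Main.v *)
(* Everything happens path by path. As [sigma >= sigma0 > 0] is Lipschitz, the
   primitive G of 1/sigma is an increasing bijection of the line (Lamperti
   transform), and X solves the equation if and only if V = G(X) - Z solves the
   ordinary differential equation V' = (drift/sigma)(t, G^-1(V + Z_t)): since Z
   and X are Hoelder of exponent larger than 1/2, all second-order terms are
   o(t - s), uniformly. The Young integral of a Hoelder solution is controlled
   on small intervals by comparing dyadic Riemann sums. The rate of the ordinary
   equation is locally Lipschitz and mean reverting, so V stays in a compact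
   set depending on the path; hence solutions of the equation with truncated
   rate are eventually independent of the truncation level M, and X_t is the
   limit as M tends to infinity of limits of Euler schemes, which gives its
   measurability in omega. *)

Require Import Defs.
From HB Require Import structures.
From mathcomp Require Import all_boot all_order all_algebra.
From mathcomp Require Import all_classical all_reals all_analysis.
From mathcomp Require Import measurable_realfun ring lra.

Set Implicit Arguments.
Unset Strict Implicit.
Unset Printing Implicit Defensive.

Import Order.TTheory GRing.Theory Num.Theory.
Import numFieldNormedType.Exports.

Local Open Scope classical_set_scope.
Local Open Scope ring_scope.

(** * Ordinary differential equations with continuous rate *)

(** The noise is scalar and Young integrals obey the ordinary chain rule, so dividing by sigma
    strips Z of its coefficient; the Taylor remainder of G is at most a multiple of (X_t - X_s)^2.
    The rate of the equation for V is only as regular in time as Z, so the ordinary equations below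
    have rates merely continuous in t. A Lipschitz sigma grows at most linearly, hence 1/sigma is
    not integrable at either infinity and G reaches every real value. Its inverse is Lipschitz on
    bounded sets only, as sigma need not be bounded; this is what forces the truncation. Derivatives
    of V and X are never formed: each equation is a first-order expansion of increments, with error
    e (t - s) for t - s < d, uniformly in s. Euler schemes satisfy it for a given e, exact solutions
    for every e, so one discrete Gronwall inequality yields both convergence of the schemes and
    uniqueness. Euler schemes are preferred to Picard iteration because each of their values is an
    explicit function of finitely many values of Z, hence measurable at once. *)

Lemma exists_fine_mesh (R : realType) (x d : R) : 0 < d ->
  exists n : nat, forall m, (n <= m)%N -> x / m.+1%:R < d.
Proof.
move=> d0; exists (Num.trunc (x / d)) => m nm.
rewrite ltr_pdivrMr // mulrC -ltr_pdivrMr //.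
by apply: (lt_le_trans (truncnS_gt _)); rewrite ler_nat.
Qed.

(** Chain the hypothesis along n + 1 equal steps of length h < d; the accumulated factor (1 + K
    h)^(n + 1) is at most exp(K t). *)
Lemma gronwall (R : realType) (T K e d : R) (W : R -> R) :
  0 <= K -> 0 <= e -> 0 < d ->
  (forall s t, 0 <= s -> s <= t -> t <= T -> t - s < d ->
     W t <= (1 + K * (t - s)) * W s + e * (t - s)) ->
  W 0 <= 0 ->
  forall t, 0 <= t -> t <= T -> W t <= e * t * expR (K * t).
Proof.
move=> K0 e0 d0 HW W0 t t0 tT.
have [n /(_ n (leqnn _)) nd] := exists_fine_mesh t d0.
pose h := t / n.+1%:R.
have h0 : 0 <= h by rewrite divr_ge0.
have hn : n.+1%:R * h = t by rewrite mulrC divfK.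
have b1 : 1 <= 1 + K * h by rewrite lerDl mulr_ge0.
have step i : (i <= n.+1)%N -> W (i%:R * h) <= e * (i%:R * h) * (1 + K * h) ^+ i.
  elim: i => [_|i IH lin]; first by rewrite mul0r mulr0 mul0r.
  have eS : i.+1%:R * h - i%:R * h = h by rewrite -natr1 mulrDl mul1r addrC addKr.
  have := HW (i%:R * h) (i.+1%:R * h).
  rewrite eS => /(_ (mulr_ge0 (ler0n _ _) h0)) /(_ _ _ nd)/le_trans; apply.
  - by rewrite ler_wpM2r // ler_nat.
  - by apply: le_trans tT; rewrite -[leRHS]hn ler_wpM2r // ler_nat.
  have {}IH := IH (ltnW lin).
  have -> : e * (i.+1%:R * h) * (1 + K * h) ^+ i.+1 =
    (1 + K * h) * (e * (i%:R * h) * (1 + K * h) ^+ i) + e * h * (1 + K * h) ^+ i.+1.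
    by rewrite exprS -natr1; ring.
  apply: lerD; first by rewrite ler_wpM2l // (le_trans ler01).
  by rewrite ler_peMr ?exprn_ege1 // mulr_ge0.
have := step n.+1 (leqnn _); rewrite hn => /le_trans; apply.
rewrite ler_wpM2l ?mulr_ge0 //.
have -> : K * t = n.+1%:R * (K * h) by rewrite mulrCA hn.
rewrite expRM_natl lerXn2r ?nnegrE ?expR_ge0 ?expR_ge1Dx //.
exact: le_trans ler01 b1.
Qed.

(** A common weakening of Euler polygons and exact solutions, so that a single comparison lemma
    handles any pair of them. *)
Definition ode_approx (R : realType) (r : R -> R -> R) (T e d : R) (V : R -> R) :=
  forall s t : R, 0 <= s -> s <= t -> t <= T -> t - s < d ->
    `|V t - V s - r s (V s) * (t - s)| <= e * (t - s).

(* [V' = r(t, V)] on [0, T], with a first-order expansion uniform in the base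
   point in place of the derivative. *)
Definition ode_solution (R : realType) (r : R -> R -> R) (T : R) (V : R -> R) :=
  forall e : R, 0 < e -> exists2 d : R, 0 < d & ode_approx r T e d V.

Lemma ode_approx_close (R : realType) (r : R -> R -> R) (T K e d : R)
    (V W : R -> R) : 0 <= K -> 0 <= e -> 0 < d ->
  (forall t v w, `|r t v - r t w| <= K * `|v - w|) ->
  ode_approx r T e d V -> ode_approx r T e d W -> V 0 = W 0 ->
  forall t, 0 <= t -> t <= T -> `|V t - W t| <= (e + e) * t * expR (K * t).
Proof.
move=> K0 e0 d0 rK HV HW VW0.
apply: (@gronwall _ _ _ _ d (fun t => `|V t - W t|)) => //.
- exact: addr_ge0.
- move=> s t s0 st tT td; have := HV s t s0 st tT td; have := HW s t s0 st tT td.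
  have := rK s (V s) (W s).
  set rv := r s (V s); set rw := r s (W s) => h1 h2 h3.
  have -> : V t - W t = (V t - V s - rv * (t - s)) - (W t - W s - rw * (t - s))
    + ((rv - rw) * (t - s) + (V s - W s)) by ring.
  apply: (le_trans (ler_normD _ _)).
  apply: (le_trans (lerD (ler_normB _ _) (ler_normD _ _))).
  rewrite normrM (ger0_norm (_ : 0 <= t - s)) ?subr_ge0 //.
  have : `|rv - rw| * (t - s) <= K * `|V s - W s| * (t - s).
    by rewrite ler_wpM2r // subr_ge0.
  by nra.
- by rewrite VW0 subrr normr0.
Qed.

Lemma ode_solution_unique (R : realType) (r : R -> R -> R) (T K : R)
    (V W : R -> R) : 0 <= K ->
  (forall t v w, `|r t v - r t w| <= K * `|v - w|) ->
  ode_solution r T V -> ode_solution r T W -> V 0 = W 0 ->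
  forall t, 0 <= t -> t <= T -> V t = W t.
Proof.
move=> K0 rK HV HW VW0 t t0 tT.
apply/eqP; rewrite -subr_eq0 -normr_le0; apply/ler_addgt0Pl => e e0; rewrite addr0.
(* At tolerance e / c the comparison bound is (e / c) (c - 1); the summand 1 keeps c positive. *)
pose c := 2 * t * expR (K * t) + 1.
have c0 : 0 < c by rewrite ltr_wpDl // !mulr_ge0 // expR_ge0.
have e'0 : 0 < e / c by rewrite divr_gt0.
have [d1 d10 h1] := HV _ e'0; have [d2 d20 h2] := HW _ e'0.
have d0 : 0 < Num.min d1 d2 by rewrite lt_min d10.
have := @ode_approx_close _ r T K _ _ V W K0 (ltW e'0) d0 rK.
move=> /(_ _ _ VW0 _ t0 tT)/le_trans; apply.
- by move=> s u s0 su uT; rewrite lt_min => /andP[*]; apply: h1.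
- by move=> s u s0 su uT; rewrite lt_min => /andP[*]; apply: h2.
have -> : (e / c + e / c) * t * expR (K * t) = e / c * (2 * t * expR (K * t)) by ring.
by rewrite -mulrA ler_piMr ?ltW // mulrC ltr_pdivrMr // mul1r ltrDl.
Qed.

(** A barrier argument: Gronwall with constant 0, applied to the excess max(0, V - m). Above m the
    rate pushes down; below m it is at most K (m - V), since it is nonpositive at m and
    K-Lipschitz. *)
Lemma ode_solution_ub (R : realType) (r : R -> R -> R) (T K m : R)
    (V : R -> R) : 0 <= K ->
  (forall t v w, `|r t v - r t w| <= K * `|v - w|) ->
  (forall t v, m <= v -> r t v <= 0) ->
  ode_solution r T V -> V 0 <= m ->
  forall t, 0 <= t -> t <= T -> V t <= m.
Proof.
move=> K0 rK rm HV V0 t t0 tT.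
rewrite -subr_le0; apply/ler_addgt0Pl => e e0; rewrite addr0.
have c0 : 0 < t + 1 by rewrite ltr_wpDl.
have e'0 : 0 < e / (t + 1) by rewrite divr_gt0.
have [d d0 h] := HV _ e'0.
(* Over a time shorter than 1 / (K + 1), a rate of at most K (m - V s) cannot carry V from below m
   to above m, apart from the error term. *)
have d'0 : 0 < Num.min d (K + 1)^-1.
  by rewrite lt_min d0 invr_gt0 ltr_wpDl.
pose W u := Num.max 0 (V u - m).
have := @gronwall _ T 0 _ _ W (lexx 0) (ltW e'0) d'0.
move=> /(_ _ _ t t0 tT) H.
have : W t <= e / (t + 1) * t * expR (0 * t).
  apply: H.
  - move=> s u s0 su uT; rewrite lt_min => /andP[usd usK].
    have us0 : 0 <= u - s by rewrite subr_ge0.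
    rewrite mul0r addr0 mul1r ge_max; apply/andP; split.
      by apply: addr_ge0; [rewrite /W le_max lexx | rewrite mulr_ge0 // ltW].
    have := h s u s0 su uT usd; rewrite ler_norml => /andP[_ {}h].
    have [ms|sm] := leP m (V s).
    + have := rm s _ ms => r0.
      apply: (@le_trans _ _ (V s - m + e / (t + 1) * (u - s))).
        by have : r s (V s) * (u - s) <= 0 by [rewrite mulr_le0_ge0|]; lra.
      by rewrite lerD2r /W le_max lexx orbT.
    + have r1 : r s (V s) <= K * (m - V s).
        have := rK s (V s) m; rewrite ler_norml => /andP[_].
        have := rm s m (lexx _).
        by rewrite ltr0_norm ?subr_lt0 // opprB; lra.
      have r2 : r s (V s) * (u - s) <= m - V s.
        apply: (@le_trans _ _ (K * (m - V s) * (u - s))); first by rewrite ler_wpM2r.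
        rewrite mulrAC ler_piMl ?subr_ge0 //; first exact: ltW.
        have K1 : 0 < K + 1 by rewrite ltr_wpDl.
        have : (u - s) * (K + 1) < 1 by rewrite -ltr_pdivlMr // mul1r.
        by lra.
      have : 0 <= W s by rewrite /W le_max lexx.
      by lra.
  - by rewrite ge_max lexx subr_le0.
rewrite mul0r expR0 mulr1 => {H} H.
apply: (@le_trans _ _ (W t)); first by rewrite /W le_max lexx orbT.
apply: (le_trans H); rewrite mulrAC ler_pdivrMr // ler_wpM2l ?ltW // ltrDl //.
Qed.

(** * The Euler scheme: polygons and their convergence *)

Fixpoint euler (R : realType) (r : R -> R -> R) (v0 h : R) (n : nat) (t : R) : R :=
  if n is i.+1 then
    euler r v0 h i t + (Num.min t (i.+1%:R * h) - Num.min t (i%:R * h)) *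
      r (i%:R * h) (euler r v0 h i (i%:R * h))
  else v0.

Lemma euler_grid (R : realType) (r : R -> R -> R) (v0 h : R) (i n : nat) :
  0 <= h -> (i <= n)%N ->
  euler r v0 h n (i%:R * h) = euler r v0 h i (i%:R * h).
Proof.
move=> h0; elim: n => [|n IH]; first by rewrite leqn0 => /eqP ->.
rewrite leq_eqVlt => /predU1P[-> //|]; rewrite ltnS => lein.
rewrite /= IH // !min_l ?subrr ?mul0r ?addr0 // ler_wpM2r ?ler_nat //.
exact: leqW.
Qed.

Lemma euler_sum (R : realType) (r : R -> R -> R) (v0 h : R) (n : nat) (t : R) :
  0 <= h -> euler r v0 h n t = v0 + \sum_(0 <= i < n)
    (Num.min t (i.+1%:R * h) - Num.min t (i%:R * h)) *
      r (i%:R * h) (euler r v0 h n (i%:R * h)).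
Proof.
move=> h0.
have -> : euler r v0 h n t = v0 + \sum_(0 <= i < n)
    (Num.min t (i.+1%:R * h) - Num.min t (i%:R * h)) *
      r (i%:R * h) (euler r v0 h i (i%:R * h)).
  elim: n => [|n IH /=]; first by rewrite big_nil addr0.
  by rewrite big_nat_recr //= addrA -IH.
congr (_ + _); apply: eq_big_nat => i /andP[_ lin].
by rewrite (euler_grid _ _ h0 (ltnW lin)).
Qed.

(** For s <= t this is the length of the intersection of [s, t] with the cell [ih, (i+1)h]: each
    difference of minima is the part of the cell lying before t, respectively s. In this form it
    telescopes over i. *)
Definition cell_overlap (R : realType) (h s t : R) (i : nat) : R :=
  (Num.min t (i.+1%:R * h) - Num.min t (i%:R * h)) -
  (Num.min s (i.+1%:R * h) - Num.min s (i%:R * h)).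

Lemma cell_overlap_ge0 (R : realType) (h s t : R) (i : nat) :
  0 <= h -> s <= t -> 0 <= cell_overlap h s t i.
Proof.
move=> h0 st; rewrite /cell_overlap -natr1 mulrDl mul1r.
by move: (i%:R * h) => a; rewrite /Num.min; do ! case: ifPn; rewrite -?leNgt; lra.
Qed.

Lemma cell_overlap_eq0 (R : realType) (h s t d : R) (i : nat) :
  0 <= h -> s <= t -> t - s <= d -> h <= d -> d < `|i%:R * h - s| ->
  cell_overlap h s t i = 0.
Proof.
move=> h0 st td hd; rewrite /cell_overlap -natr1 mulrDl mul1r.
move: (i%:R * h) => a; rewrite ltr_normr => /orP[] H;
  by rewrite /Num.min; do ! case: ifPn; rewrite -?leNgt; lra.
Qed.

Lemma sum_cell_overlap (R : realType) (h s t : R) (n : nat) :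
  0 <= s -> s <= t -> t <= n%:R * h ->
  \sum_(0 <= i < n) cell_overlap h s t i = t - s.
Proof.
move=> s0 st tn; rewrite sumrB.
rewrite (telescope_sumr (fun i => Num.min t (i%:R * h))) //.
rewrite (telescope_sumr (fun i => Num.min s (i%:R * h))) //.
rewrite mul0r !(min_r s0, min_r (le_trans s0 st)) !subr0.
by rewrite !min_l // (le_trans st).
Qed.

Lemma euler_diff (R : realType) (r : R -> R -> R) (v0 h s t x : R) (n : nat) :
  0 <= h -> 0 <= s -> s <= t -> t <= n%:R * h ->
  `|euler r v0 h n t - euler r v0 h n s - x * (t - s)| <=
  \sum_(0 <= i < n) cell_overlap h s t i *
    `|r (i%:R * h) (euler r v0 h n (i%:R * h)) - x|.
Proof.
move=> h0 s0 st tn.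
rewrite !(euler_sum _ _ _ _ h0) [v0 + _]addrC addrKA -sumrB.
rewrite -(sum_cell_overlap s0 st tn) mulr_sumr -sumrB.
apply: (le_trans (ler_norm_sum _ _ _)).
rewrite le_eqVlt; apply/orP; left; apply/eqP; apply: eq_bigr => i _.
by rewrite -mulrBl [x * _]mulrC -mulrBr normrM ger0_norm // cell_overlap_ge0.
Qed.

Lemma euler_lipschitz (R : realType) (r : R -> R -> R) (B v0 h s t : R) (n : nat) :
  (forall u v, `|r u v| <= B) ->
  0 <= h -> 0 <= s -> s <= t -> t <= n%:R * h ->
  `|euler r v0 h n t - euler r v0 h n s| <= B * (t - s).
Proof.
move=> rB h0 s0 st tn.
have := @euler_diff _ r v0 h s t 0 n h0 s0 st tn.
rewrite mul0r subr0 => /le_trans; apply.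
rewrite -(sum_cell_overlap s0 st tn) mulr_sumr; apply: ler_sum => i _.
by rewrite subr0 mulrC ler_wpM2r // cell_overlap_ge0.
Qed.

(** An increment of the polygon is a sum of rates frozen at grid points, weighted by overlaps. Only
    grid points within d of s carry weight, and between them and s the polygon moves by at most B
    d. *)
Lemma euler_ode_approx (R : realType) (r : R -> R -> R)
    (B K eta d T v0 h : R) (n : nat) :
  0 <= K -> (forall u v, `|r u v| <= B) ->
  (forall u u' v w, `|u - u'| <= d -> `|r u v - r u' w| <= eta + K * `|v - w|) ->
  0 <= h -> h <= d -> T <= n%:R * h ->
  ode_approx r T (eta + K * (B * d)) d (euler r v0 h n).
Proof.
move=> K0 rB rd h0 hd Tn s t s0 st tT td.
have tn := le_trans tT Tn.
apply: (le_trans (euler_diff _ _ _ h0 s0 st tn)).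
rewrite -(sum_cell_overlap s0 st tn) mulr_sumr.
have B0 : 0 <= B := le_trans (normr_ge0 _) (rB 0 0).
rewrite big_nat [leRHS]big_nat; apply: ler_sum => i /andP[_ lin].
have [di|id] := ltP d `|i%:R * h - s|.
  by rewrite (@cell_overlap_eq0 _ h s t d) ?(ltW td) // mul0r mulr0.
rewrite mulrC ler_wpM2r ?cell_overlap_ge0 //.
apply: (le_trans (rd _ _ _ _ id)); rewrite lerD2l ler_wpM2l //.
have ih0 : 0 <= i%:R * h by rewrite mulr_ge0.
have ihn : i%:R * h <= n%:R * h by rewrite ler_wpM2r // ler_nat ltnW.
apply: (@le_trans _ _ (B * `|i%:R * h - s|)); last by rewrite ler_wpM2l.
have [lis|lsi] := leP (i%:R * h) s.
- rewrite distrC [`|_ * h - s|]distrC (ger0_norm (_ : 0 <= s - _)) ?subr_ge0 //.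
  exact: euler_lipschitz (le_trans st tn).
- rewrite (ger0_norm (_ : 0 <= _ - s)) ?subr_ge0; last exact: ltW.
  by apply: euler_lipschitz => //; rewrite ltW.
Qed.

(** The n-th scheme has n + 1 steps, so that the step is defined for n = 0 and the grid ends exactly
    at T. *)
Definition euler_limit (R : realType) (r : R -> R -> R) (T v0 t : R) : R :=
  limn (fun n => euler r v0 (T / n.+1%:R) n.+1 t).

Section euler_limit.
Variables (R : realType) (r : R -> R -> R) (B K T v0 : R).
Hypotheses (K0 : 0 <= K) (T0 : 0 < T) (rB : forall u v, `|r u v| <= B).
Hypothesis rK : forall u v w, `|r u v - r u w| <= K * `|v - w|.
Hypothesis r_unif : forall e : R, 0 < e -> exists2 d : R, 0 < d &
  forall u u' v, `|u - u'| <= d -> `|r u v - r u' v| <= e.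

Let v n t := euler r v0 (T / n.+1%:R) n.+1 t.

Let v_at0 n : v n 0 = v0.
Proof.
rewrite /v -(mul0r (T / n.+1%:R)) (@euler_grid _ _ _ _ 0) //.
by rewrite divr_ge0 // ltW.
Qed.

Let euler_eventually_approx e : 0 < e -> exists2 d, 0 < d &
  exists n, forall m, (n <= m)%N -> ode_approx r T e d (v m).
Proof.
move=> e0; have e20 : 0 < e / 2 by rewrite divr_gt0.
have B0 : 0 <= B := le_trans (normr_ge0 _) (rB 0 0).
have [d1 d10 H1] := r_unif e20.
have c0 : 0 < K * B + 1 by rewrite ltr_wpDl // mulr_ge0.
(* Half of e pays for the variation of the rate in time, half for the displacement term K B d. *)
pose d := Num.min d1 (e / 2 / (K * B + 1)).
have d0 : 0 < d by rewrite lt_min d10 divr_gt0.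
exists d => //; have [n Hn] := exists_fine_mesh T d0; exists n => m nm.
have H : ode_approx r T (e / 2 + K * (B * d)) d (v m).
  apply: euler_ode_approx => //.
  - move=> u u' x y; rewrite le_min => /andP[ud1 _].
    have -> : r u x - r u' y = (r u x - r u' x) + (r u' x - r u' y) by ring.
    by apply: (le_trans (ler_normD _ _)); apply: lerD; [exact: H1|exact: rK].
  - by rewrite divr_ge0 // ltW.
  - by apply/ltW/Hn.
  - by rewrite mulrC divfK.
move=> s t s0 st tT td; apply: (le_trans (H s t s0 st tT td)).
rewrite ler_wpM2r ?subr_ge0 // [leRHS](splitr e) lerD2l mulrA.
apply: (@le_trans _ _ ((K * B + 1) * d)); first by rewrite ler_wpM2r ?lerDl // ltW.
by rewrite mulrC -ler_pdivlMr // /d ge_min lexx orbT.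
Qed.

(** Two fine schemes are approximate solutions with the same initial value, hence close by Gronwall:
    the sequence is Cauchy, and no compactness is involved. *)
Lemma cvg_euler_limit t : 0 <= t -> t <= T -> cvgn (v ^~ t).
Proof.
move=> t0 tT; apply: cauchy_cvg; apply: cauchy_exP => e e0.
pose c := 2 * t * expR (K * t) + 1.
have c0 : 0 < c by rewrite ltr_wpDl // !mulr_ge0 // expR_ge0.
have e'0 : 0 < e / c by rewrite divr_gt0.
have [d d0 [n Hn]] := euler_eventually_approx e'0.
exists (v n t); exists n => // m /= nm; rewrite /ball /=.
have vm := Hn _ nm; have vn := Hn _ (leqnn n).
apply: le_lt_trans (ode_approx_close K0 (ltW e'0) d0 rK vn vm _ t0 tT) _.
  by rewrite !v_at0.
have -> : (e / c + e / c) * t * expR (K * t) = e / c * (2 * t * expR (K * t)) by ring.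
by rewrite -mulrA gtr_pMr // mulrC ltr_pdivrMr // mul1r ltrDl.
Qed.

Lemma euler_limit0 : euler_limit r T v0 0 = v0.
Proof.
rewrite /euler_limit; apply: cvg_lim => //.
rewrite (_ : (fun _ => _) = fun=> v0); first exact: cvg_cst.
by apply/funext => n; exact: v_at0.
Qed.

(** The scale d of the expansion is the same for all fine schemes, so the inequality passes to the
    pointwise limit. *)
Lemma euler_limit_solution : ode_solution r T (euler_limit r T v0).
Proof.
move=> e e0; have [d d0 [n Hn]] := euler_eventually_approx e0.
exists d => // s t s0 st tT td.
have cs := cvg_euler_limit s0 (le_trans st tT).
have ct := cvg_euler_limit (le_trans s0 st) tT.
have H : (fun m => `|v m t - v m s - r s (v m s) * (t - s)|) @ \oo -->
  `|euler_limit r T v0 t - euler_limit r T v0 s -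
    r s (euler_limit r T v0 s) * (t - s)|.
  apply: cvg_norm; apply: cvgB; first exact: cvgB.
  apply: cvgM; last exact: cvg_cst.
  apply/cvgrPdist_le => /= eps eps0.
  have c0 : 0 < K + 1 by rewrite ltr_wpDl.
  have /cvgrPdist_le/(_ (eps / (K + 1))) := cs.
  rewrite divr_gt0 // => /(_ isT); apply: filterS => m Hm.
  apply: (le_trans (rK _ _ _)); rewrite mulrC.
  apply: (@le_trans _ _ (eps / (K + 1) * (K + 1))); last by rewrite divfK ?gt_eqF.
  by apply: ler_pM => //; rewrite lerDl.
rewrite -(cvg_lim _ H) //; apply: limr_le; first by apply: cvgP H.
by exists n => // m nm; apply: Hn.
Qed.

Lemma euler_limit_lipschitz s t : 0 <= s -> s <= t -> t <= T ->
  `|euler_limit r T v0 t - euler_limit r T v0 s| <= B * (t - s).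
Proof.
move=> s0 st tT.
have cs := cvg_euler_limit s0 (le_trans st tT).
have ct := cvg_euler_limit (le_trans s0 st) tT.
have H : (fun m => `|v m t - v m s|) @ \oo -->
  `|euler_limit r T v0 t - euler_limit r T v0 s|.
  by apply: cvg_norm; apply: cvgB.
rewrite -(cvg_lim _ H) //; apply: limr_le; first by apply: cvgP H.
apply: nearW => n; apply: euler_lipschitz => //; first by rewrite divr_ge0 // ltW.
by rewrite mulrC divfK.
Qed.

End euler_limit.

(** * The Lamperti transform *)

Lemma continuous_segment_integrable (R : realType) (f : R -> R) (a b : R) :
  continuous f ->
  lebesgue_measure.-integrable `[a, b] (EFin \o (f : measurableTypeR R -> R)).
Proof.
move=> fc; apply: continuous_compact_integrable; first exact: segment_compact.
by apply: continuous_subspaceT => x; exact: fc.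
Qed.

Lemma Rintegral_segmentB (R : realType) (f : measurableTypeR R -> R) (a b c : R) :
  a <= b -> b <= c -> lebesgue_measure.-integrable `[a, c] (EFin \o f) ->
  \int[lebesgue_measure]_(x in `[a, c]) f x -
  \int[lebesgue_measure]_(x in `[a, b]) f x =
  \int[lebesgue_measure]_(x in `[b, c]) f x.
Proof.
move=> ab bc fi.
rewrite Rintegral_itvB ?bnd_simp // Rintegral_itv_obnd_cbnd //.
apply: integrableS fi => //; apply: subset_itv; rewrite bnd_simp //.
Qed.

Lemma Rintegral_segment_bounds (R : realType) (f : measurableTypeR R -> R)
    (a b m M : R) :
  a <= b -> lebesgue_measure.-integrable `[a, b] (EFin \o f) ->
  (forall x, a <= x -> x <= b -> m <= f x <= M) ->
  m * (b - a) <= \int[lebesgue_measure]_(x in `[a, b]) f x <= M * (b - a).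
Proof.
move=> ab fi fb.
have mu_ab : fine (lebesgue_measure (`[a, b]%classic : set (measurableTypeR R))) = b - a.
  rewrite lebesgue_measure_itv /= lte_fin; case: ltP => // ba.
  have -> : a = b by apply/le_anti; rewrite ab ba.
  by rewrite subrr.
have cst_int k : k * (b - a) = \int[lebesgue_measure]_(x in `[a, b]) k.
  by rewrite Rintegral_cst // mu_ab.
have ci k : lebesgue_measure.-integrable `[a, b]
    (EFin \o (fun _ : measurableTypeR R => k : R)).
  by apply: continuous_segment_integrable => x; exact: cvg_cst.
rewrite !cst_int; apply/andP; split; apply: le_Rintegral => // x /=;
  by rewrite in_itv /= => /andP[ax xb]; have /andP[] := fb _ ax xb.
Qed.

(** The oriented integral of 1/sigma from 0 to x: an interval with reversed ends is empty, so one of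
    the two terms always vanishes. *)
Definition lamperti (R : realType) (sigma : R -> R) (x : R) : R :=
  \int[lebesgue_measure]_(u in `[0, x]) (sigma u)^-1 -
  \int[lebesgue_measure]_(u in `[x, 0]) (sigma u)^-1.

Definition lamperti_inv (R : realType) (sigma : R -> R) (u : R) : R :=
  xget 0 [set x | lamperti sigma x = u].

Section lamperti.
Variables (R : realType) (sigma : R -> R) (s0 L : R).
Hypotheses (s0_gt0 : 0 < s0) (sigma_ge : forall x, s0 <= sigma x).
Hypothesis sigma_lip : forall x y, `|sigma x - sigma y| <= L * `|x - y|.

Let G := lamperti sigma.
Let psi := lamperti_inv sigma.

Let sigma_gt0 x : 0 < sigma x. Proof. exact: lt_le_trans (sigma_ge x). Qed.

Let L0 : 0 <= L.
Proof.
have := sigma_lip 1 0; rewrite subr0 normr1 mulr1; exact: le_trans.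
Qed.

Lemma inv_sigma_lip x y : `|(sigma x)^-1 - (sigma y)^-1| <= L / s0 ^+ 2 * `|x - y|.
Proof.
have -> : (sigma x)^-1 - (sigma y)^-1 = (sigma y - sigma x) / (sigma x * sigma y).
  by field; rewrite !gt_eqF.
rewrite normrM distrC normfV (gtr0_norm (mulr_gt0 _ _)) // mulrAC.
apply: ler_pM => //; first by rewrite invr_ge0 mulr_ge0 // ltW.
rewrite lef_pV2 ?posrE ?mulr_gt0 ?exprn_gt0 // expr2.
by apply: ler_pM; rewrite // ltW.
Qed.

Let invsigma_cont : continuous (fun x => (sigma x)^-1).
Proof.
move=> x; apply/cvgrPdist_le => /= e e0.
have c0 : 0 < L / s0 ^+ 2 + 1 by rewrite ltr_wpDl // divr_ge0 // exprn_ge0 // ltW.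
near=> y; apply: (le_trans (inv_sigma_lip _ _)).
apply: (@le_trans _ _ ((L / s0 ^+ 2 + 1) * `|x - y|)).
  by rewrite ler_wpM2r // lerDl.
rewrite mulrC -ler_pdivlMr // ltW //.
by near: y; exact: (nbhsx_ballx x _ (divr_gt0 e0 c0)).
Unshelve. all: by end_near. Qed.

Let int_invsigma a b : lebesgue_measure.-integrable `[a, b]
  (EFin \o ((fun x => (sigma x)^-1) : measurableTypeR R -> R)).
Proof. exact: continuous_segment_integrable. Qed.

Let lamperti_diff x y : x <= y ->
  G y - G x = \int[lebesgue_measure]_(u in `[x, y]) (sigma u)^-1.
Proof.
have I0 a : \int[lebesgue_measure]_(u in `[a, a]) (sigma u)^-1 = 0 :> R.
  by rewrite set_itv1 Rintegral_set1.
have Ige a b : b <= a -> \int[lebesgue_measure]_(u in `[a, b]) (sigma u)^-1 = 0 :> R.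
  rewrite le_eqVlt => /predU1P[->//|ba].
  by rewrite set_itv_ge ?Rintegral_set0 // -leNgt /= bnd_simp.
move=> xy; rewrite /G /lamperti; have [x0|x0] := leP 0 x.
- rewrite (Ige y 0) ?(le_trans x0) // (Ige x 0) // !subr0.
  exact: Rintegral_segmentB.
- have {}x0 := ltW x0; rewrite (Ige 0 x) //; have [y0|y0] := leP 0 y.
  + rewrite (Ige y 0) // subr0 sub0r opprK.
    have := @Rintegral_segmentB _ (fun u => (sigma u)^-1) x 0 y x0 y0 (int_invsigma _ _).
    by move=> <-; rewrite subrK.
  + have {}y0 := ltW y0; rewrite (Ige 0 y) // !sub0r opprK.
    have := @Rintegral_segmentB _ (fun u => (sigma u)^-1) x y 0 xy y0 (int_invsigma _ _).
    by move=> <-; rewrite opprB subrK.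
Qed.

Lemma lamperti_bounds x y m M : x <= y ->
  (forall u, x <= u -> u <= y -> m <= (sigma u)^-1 <= M) ->
  m * (y - x) <= G y - G x <= M * (y - x).
Proof. by move=> xy H; rewrite lamperti_diff //; exact: Rintegral_segment_bounds. Qed.

Lemma lamperti_lip x y : `|G x - G y| <= s0^-1 * `|x - y|.
Proof.
wlog xy : x y / x <= y.
  by move=> H; have [/H//|/ltW/H] := leP x y; rewrite distrC [`|y - x|]distrC.
rewrite distrC [`|x - y|]distrC (ger0_norm (_ : 0 <= y - x)) ?subr_ge0 //.
have /andP[h1 h2] : 0 * (y - x) <= G y - G x <= s0^-1 * (y - x).
  apply: lamperti_bounds => // u _ _; rewrite invr_ge0 ltW //=.
  by rewrite lef_pV2 ?posrE.
by rewrite ger0_norm //; move: h1; rewrite mul0r.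
Qed.

(** On [x, y] the Lipschitz bound gives sigma <= sigma p + L (y - x). The base point p is free so
    that the end nearer to the origin can be chosen on either half-line. *)
Lemma lamperti_growth x y p : x <= p -> p <= y ->
  (y - x) / (sigma p + L * (y - x)) <= G y - G x.
Proof.
move=> xp py; have xy := le_trans xp py.
rewrite mulrC.
have /andP[//] : (sigma p + L * (y - x))^-1 * (y - x) <= G y - G x <= s0^-1 * (y - x).
apply: lamperti_bounds => // u xu uy; rewrite !lef_pV2 ?posrE ?sigma_ge //.
- rewrite andbT -lerBlDl (le_trans (ler_norm _)) // (le_trans (sigma_lip _ _)) //.
  rewrite ler_wpM2l // ler_norml; lra.
- by rewrite ltr_wpDr // mulr_ge0 // subr_ge0.
Qed.

Lemma lamperti_lt x y : x < y -> G x < G y.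
Proof.
move=> xy; rewrite -subr_gt0.
apply: (lt_le_trans _ (lamperti_growth (lexx x) (ltW xy))).
by rewrite divr_gt0 ?subr_gt0 // ltr_wpDr // mulr_ge0 // subr_ge0 ltW.
Qed.

Lemma lamperti_inj : injective G.
Proof.
move=> x y Gxy; apply/eqP; case: ltgtP => // /lamperti_lt; rewrite Gxy ltxx //.
Qed.

Lemma lamperti_le x y : (G x <= G y) = (x <= y).
Proof.
have [/lamperti_lt|yx|->] := ltgtP x y; rewrite ?lexx //; first exact: ltW.
by apply/negbTE; rewrite -ltNge lamperti_lt.
Qed.

(** The chain rule in the form used later: 1/sigma is Lipschitz, and its Lipschitz constant controls
    the quadratic remainder of its primitive. *)
Lemma lamperti_expansion x y :
  `|G y - G x - (y - x) / sigma x| <= L / s0 ^+ 2 * (y - x) ^+ 2.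
Proof.
pose c := L / s0 ^+ 2 * `|y - x|.
have near_x u : `|u - x| <= `|y - x| ->
    (sigma x)^-1 - c <= (sigma u)^-1 <= (sigma x)^-1 + c.
  move=> ux; rewrite -ler_distl (le_trans (inv_sigma_lip _ _)) //.
  by rewrite ler_wpM2l // divr_ge0 // exprn_ge0 // ltW.
rewrite -(real_normK (num_real (y - x))) [_ ^+ 2 in leRHS]expr2 mulrA -/c.
have [xy|/ltW yx] := leP x y.
- have := @lamperti_bounds x y ((sigma x)^-1 - c) ((sigma x)^-1 + c) xy.
  have -> : `|y - x| = y - x by rewrite ger0_norm ?subr_ge0.
  case/(_ _)/andP.
    move=> u xu uy; apply: near_x; rewrite !ger0_norm ?subr_ge0 //; lra.
  by rewrite ler_norml => *; lra.
- have := @lamperti_bounds y x ((sigma x)^-1 - c) ((sigma x)^-1 + c) yx.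
  have -> : `|y - x| = x - y by rewrite ler0_norm ?subr_le0 // opprB.
  case/(_ _)/andP.
    move=> u yu ux; apply: near_x; rewrite !ler0_norm ?subr_le0 //; lra.
  by rewrite ler_norml => *; lra.
Qed.

(* [lamperti] grows by a fixed amount from [2^i - 1] to [2^(i+1) - 1], where
   [sigma] is at most a multiple of [2^i]. *)
Let lamperti_large n : exists x,
  n%:R * (sigma 0 + L + L)^-1 <= G x /\ G (- x) <= - (n%:R * (sigma 0 + L + L)^-1).
Proof.
have G0 : G 0 = 0 by rewrite /G /lamperti subrr.
have c0 : 0 < sigma 0 + L + L by rewrite !ltr_wpDr.
have inc i : (sigma 0 + L + L)^-1 <= G (2 ^+ i.+1 - 1) - G (2 ^+ i - 1) /\
   (sigma 0 + L + L)^-1 <= G (- (2 ^+ i - 1)) - G (- (2 ^+ i.+1 - 1)).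
  set a : R := 2 ^+ i; have a1 : 1 <= a by rewrite exprn_ege1 // ler1n.
  rewrite exprS -/a.
  have gr p : `|p| <= a - 1 -> (sigma 0 + L + L)^-1 <= a / (sigma p + L * a).
    move=> pa; have a0 : 0 <= a := le_trans ler01 a1.
    rewrite ler_pdivlMr; last by rewrite ltr_wpDr // mulr_ge0.
    rewrite mulrC ler_pdivrMr //.
    have := sigma_lip p 0; rewrite subr0 => H.
    have {H} : sigma p <= sigma 0 + L * `|p|.
      by rewrite -lerBlDl (le_trans (ler_norm _)).
    have : L * `|p| <= L * (a - 1) by rewrite ler_wpM2l.
    have : sigma 0 <= a * sigma 0 by rewrite ler_peMl // ltW.
    by have := L0; lra.
  split.
  - have e : (2 * a - 1) - (a - 1) = a by ring.
    have := @lamperti_growth (a - 1) (2 * a - 1) (a - 1); rewrite e.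
    move=> /(_ _ _)/(le_trans (gr _ _)); apply; rewrite ?lexx //; last by lra.
    by rewrite ger0_norm // subr_ge0.
  - have e : - (a - 1) - - (2 * a - 1) = a by ring.
    have := @lamperti_growth (- (2 * a - 1)) (- (a - 1)) (- (a - 1)); rewrite e.
    move=> /(_ _ _)/(le_trans (gr _ _)); apply; rewrite ?lexx //; last by lra.
    by rewrite normrN ger0_norm // subr_ge0.
exists (2 ^+ n - 1); elim: n => [|n [IH1 IH2]].
  by rewrite expr0 subrr oppr0 G0 mul0r oppr0.
have [i1 i2] := inc n; rewrite -natr1 mulrDl mul1r; split; lra.
Qed.

Lemma lamperti_onto u : exists x, G x = u.
Proof.
have c0 : 0 < sigma 0 + L + L by rewrite !ltr_wpDr.
pose n := (Num.trunc (`|u| * (sigma 0 + L + L))).+1.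
have un : `|u| <= n%:R * (sigma 0 + L + L)^-1.
  by rewrite ler_pdivlMr // ltW // truncnS_gt.
have [x [h1 h2]] := lamperti_large n.
move: un; rewrite ler_norml => /andP[u1 u2].
have l1 : G (- x) <= u by apply: le_trans u1.
have l2 : u <= G x by apply: le_trans h1.
have xx : - x <= x by rewrite -lamperti_le (le_trans l1).
have Gc : continuous G.
  move=> z; apply/cvgrPdist_le => /= e e0; near=> y.
  rewrite (le_trans (lamperti_lip _ _)) // mulrC ler_pdivrMr // ltW //.
  by near: y; exact: (nbhsx_ballx z _ (mulr_gt0 e0 s0_gt0)).
have := @IVT _ G (- x) x u xx.
case; first by apply: continuous_subspaceT.
  by rewrite ge_min l1 le_max l2 orbT.
by move=> c _ <-; exists c.
Unshelve. all: by end_near. Qed.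

Lemma lamperti_invK u : G (psi u) = u.
Proof.
rewrite /psi /lamperti_inv; have [x Gx] := lamperti_onto u.
exact: (@xgetPex _ 0 [set y | lamperti sigma y = u] (ex_intro _ x Gx)).
Qed.

Lemma lampertiK x : psi (G x) = x.
Proof. by apply: lamperti_inj; rewrite lamperti_invK. Qed.

Lemma lamperti_inv_le u v : (psi u <= psi v) = (u <= v).
Proof. by rewrite -lamperti_le !lamperti_invK. Qed.

Lemma lamperti_expanding x y D :
  (forall u, Num.min x y <= u -> u <= Num.max x y -> sigma u <= D) ->
  `|x - y| <= D * `|G x - G y|.
Proof.
wlog xy : x y / x <= y.
  move=> H; case/orP: (le_total x y) => /H //.
  by rewrite minC maxC (distrC y) (distrC (G y)).
rewrite (min_idPl xy) (max_idPr xy) => HD.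
have D0 : 0 < D by apply: (lt_le_trans (sigma_gt0 x)); exact: HD.
rewrite distrC [`|G x - G y|]distrC (ger0_norm (_ : 0 <= y - x)) ?subr_ge0 //.
rewrite ger0_norm ?subr_ge0 ?lamperti_le // mulrC -ler_pdivrMr // mulrC.
have /andP[//] : D^-1 * (y - x) <= G y - G x <= s0^-1 * (y - x).
apply: lamperti_bounds => // u xu uy; rewrite !lef_pV2 ?posrE ?sigma_ge //.
by rewrite HD.
Qed.

(** By monotonicity [psi] maps [-M, M] into the interval between its end values, where sigma is
    bounded; that bound is a Lipschitz constant of the inverse. [D] adds the two bounds so as to
    serve in all three estimates. *)
Lemma lamperti_inv_lip M : exists2 D, 0 < D & forall u v, `|u| <= M -> `|v| <= M ->
  [/\ `|psi u| <= D, sigma (psi u) <= D & `|psi u - psi v| <= D * `|u - v|].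
Proof.
pose r := Num.max `|psi M| `|psi (- M)|.
have r0 : 0 <= r by rewrite le_max normr_ge0.
have psi_r u : `|u| <= M -> `|psi u| <= r.
  rewrite ler_norml => /andP[].
  rewrite -(lamperti_inv_le u M) -(lamperti_inv_le _ u) => h1 h2.
  rewrite ler_norml; apply/andP; split.
    by apply: le_trans h1; rewrite lerNl (le_trans (ler_norm _)) // normrN le_max lexx orbT.
  by apply: (le_trans h2); rewrite (le_trans (ler_norm _)) // le_max lexx.
have sr x : `|x| <= r -> sigma x <= sigma 0 + L * r.
  move=> xr; have := sigma_lip x 0; rewrite subr0 => H.
  rewrite -lerBlDl (le_trans (ler_norm _)) // (le_trans H) // ler_wpM2l //.
have Lr : 0 <= L * r by rewrite mulr_ge0.
have D0 : 0 < r + (sigma 0 + L * r) by rewrite ltr_wpDl // ltr_wpDr.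
exists (r + (sigma 0 + L * r)) => // u v uM vM; split.
- by rewrite (le_trans (psi_r _ uM)) // lerDl addr_ge0 // ltW.
- by rewrite (le_trans (sr _ (psi_r _ uM))) // lerDr.
rewrite -{2}(lamperti_invK u) -{2}(lamperti_invK v).
apply: lamperti_expanding => w; rewrite ge_min le_max => w1 w2.
apply: (@le_trans _ _ (sigma 0 + L * r)); last by rewrite lerDr.
apply: sr; have := psi_r _ uM; have := psi_r _ vM.
rewrite !ler_norml => /andP[? ?] /andP[? ?].
by case/orP: w1 => ?; case/orP: w2 => ?; lra.
Qed.

End lamperti.

(** * Young integrals of Hoelder paths *)

Lemma powR_le_near0 (R : realType) (C p e : R) : 0 < p -> 0 < e ->
  exists2 d : R, 0 < d & forall x, 0 <= x -> x <= d -> C * x `^ p <= e.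
Proof.
move=> p0 e0; have c0 : 0 < `|C| + 1 by rewrite ltr_wpDl.
have ec0 : 0 < e / (`|C| + 1) by rewrite divr_gt0.
exists ((e / (`|C| + 1)) `^ p^-1); first exact: powR_gt0.
move=> x x0 xd.
have xp : x `^ p <= e / (`|C| + 1).
  apply: le_trans (_ : (e / (`|C| + 1)) `^ p^-1 `^ p <= _).
    by rewrite ge0_ler_powR ?nnegrE ?powR_ge0 // ltW.
  by rewrite -powRrM mulVf ?gt_eqF // powRr1 // ltW.
apply: (@le_trans _ _ ((`|C| + 1) * x `^ p)).
  by rewrite ler_wpM2r ?powR_ge0 // (le_trans (ler_norm _)) // lerDl.
by rewrite mulrC -ler_pdivlMr.
Qed.

Lemma powR_superlinear_near0 (R : realType) (C p e : R) : 1 < p -> 0 < e ->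
  exists2 d : R, 0 < d & forall x, 0 <= x -> x <= d -> C * x `^ p <= e * x.
Proof.
move=> p1 e0; have p0 : 0 < p - 1 by rewrite subr_gt0.
have [d d0 H] := powR_le_near0 C p0 e0; exists d => // x x0 xd.
rewrite -(mulr_powRB1 x0 (lt_trans ltr01 p1)) [x * _]mulrC.
by rewrite mulrA ler_wpM2r // H.
Qed.

Definition uniformly_continuous_upto (R : realType) (T : R) (f : R -> R) :=
  forall e : R, 0 < e -> exists2 d : R, 0 < d &
    forall s t : R, 0 <= s -> s <= t -> t <= T -> t - s < d -> `|f t - f s| <= e.

(* The form in which Hoelder exponents larger than 1/2 enter every
   second-order remainder. *)
Definition small_squares (R : realType) (T : R) (f : R -> R) :=
  forall e : R, 0 < e -> exists2 d : R, 0 < d &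
    forall s t : R, 0 <= s -> s <= t -> t <= T -> t - s < d ->
      (f t - f s) ^+ 2 <= e * (t - s).

Lemma holder_small_squares (R : realType) (lam T : R) (f : R -> R) :
  2^-1 < lam -> holder_on lam 0 T f -> small_squares T f.
Proof.
move=> lam2 [C HC] e e0.
have lam1 : 1 < lam + lam by lra.
have [d d0 H] := powR_superlinear_near0 (C ^+ 2) lam1 e0.
exists d => // s t s0 st tT td.
have ts0 : 0 <= t - s by rewrite subr_ge0.
apply: le_trans (H _ ts0 (ltW td)).
have := HC s t; rewrite !in_itv /= s0 (le_trans st tT) (le_trans s0 st) tT.
move=> /(_ isT isT); rewrite (ger0_norm ts0) => h.
rewrite powRD; last by rewrite gt_eqF // (lt_trans ltr01).
have -> : C ^+ 2 * ((t - s) `^ lam * (t - s) `^ lam) = (C * (t - s) `^ lam) ^+ 2 by ring.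
by rewrite -(real_normK (num_real (f t - f s))) lerXn2r // ?nnegrE // (le_trans _ h).
Qed.

Lemma small_squares_unif (R : realType) (T : R) (f : R -> R) :
  small_squares T f -> uniformly_continuous_upto T f.
Proof.
move=> Hf e e0; have e20 : 0 < e ^+ 2 by rewrite exprn_gt0.
have [d d0 H] := Hf _ e20.
exists (Num.min d 1); first by rewrite lt_min d0 ltr01.
move=> s t s0 st tT; rewrite lt_min => /andP[td t1].
rewrite -(ler_pXn2r (_ : 0 < 2)%N) ?nnegrE ?(ltW e0) // real_normK ?num_real //.
apply: (le_trans (H s t s0 st tT td)); by rewrite ler_piMr ?(ltW e20) // ltW.
Qed.

(** Used for two purposes: truncating the state in the rate, and extending a path beyond [0, T] by
    its end values. *)
Definition clamp (R : realType) (lo hi x : R) : R := Num.max lo (Num.min x hi).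

Lemma clamp_itv (R : realType) (lo hi x : R) : lo <= hi ->
  lo <= clamp lo hi x <= hi.
Proof. by move=> lohi; rewrite /clamp le_max lexx /= ge_max lohi ge_min lexx orbT. Qed.

Lemma clamp_id (R : realType) (lo hi x : R) : lo <= x -> x <= hi -> clamp lo hi x = x.
Proof. by move=> lox xhi; rewrite /clamp min_l // max_r. Qed.

Lemma clamp_le_mono (R : realType) (lo hi x y : R) : x <= y ->
  clamp lo hi x <= clamp lo hi y.
Proof.
by move=> xy; rewrite /clamp /Num.max /Num.min; do ! case: ifPn; rewrite -?leNgt; lra.
Qed.

Lemma clamp_lip (R : realType) (lo hi x y : R) :
  `|clamp lo hi x - clamp lo hi y| <= `|x - y|.
Proof.
wlog xy : x y / x <= y.
  move=> H; case/orP: (le_total x y) => /H //.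
  by rewrite distrC [`|y - x|]distrC.
rewrite distrC [`|x - y|]distrC !ger0_norm ?subr_ge0 ?clamp_le_mono //.
by rewrite /clamp /Num.max /Num.min; do ! case: ifPn; rewrite -?leNgt; lra.
Qed.

Lemma uniformly_continuous_clamp (R : realType) (T : R) (f : R -> R) : 0 <= T ->
  uniformly_continuous_upto T f -> forall e : R, 0 < e -> exists2 d : R, 0 < d &
  forall s t : R, `|s - t| < d -> `|f (clamp 0 T s) - f (clamp 0 T t)| <= e.
Proof.
move=> T0 Hf e e0; have [d d0 H] := Hf e e0; exists d => // s t.
wlog st : s t / s <= t.
  move=> {}H; case/orP: (le_total s t) => /H //.
  by rewrite distrC [`|f _ - _|]distrC.
move=> std; rewrite distrC.
have /andP[s0 sT] := clamp_itv s T0; have /andP[t0 tT] := clamp_itv t T0.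
have c := clamp_le_mono 0 T st.
apply: H => //; apply: le_lt_trans std; rewrite distrC.
apply: le_trans (clamp_lip 0 T t s); exact: ler_norm.
Qed.

Lemma uniformly_continuous_integrable (R : realType) (T t : R) (f : R -> R) :
  0 <= t -> t <= T -> uniformly_continuous_upto T f ->
  lebesgue_measure.-integrable `[0, t] (EFin \o (f : measurableTypeR R -> R)).
Proof.
move=> t0 tT Hf; have T0 := le_trans t0 tT.
have fc : continuous (f \o clamp 0 T).
  move=> x; apply/cvgrPdist_le => /= e e0.
  have [d d0 H] := uniformly_continuous_clamp T0 Hf e0.
  by near=> y; apply: H; near: y; exact: (nbhsx_ballx x _ d0).
apply: eq_integrable (continuous_segment_integrable 0 t fc) => // x.
by rewrite inE /= in_itv /= => /andP[x0 xt]; rewrite clamp_id // (le_trans xt).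
Unshelve. all: by end_near. Qed.

Lemma Rintegral_expansion (R : realType) (T : R) (f : R -> R) :
  uniformly_continuous_upto T f ->
  forall e : R, 0 < e -> exists2 d : R, 0 < d &
    forall s t : R, 0 <= s -> s <= t -> t <= T -> t - s < d ->
    `|\int[lebesgue_measure]_(u in `[0, t]) f u -
      \int[lebesgue_measure]_(u in `[0, s]) f u - f s * (t - s)| <= e * (t - s).
Proof.
move=> Hf e e0; have [d d0 H] := Hf e e0; exists d => // s t s0 st tT td.
have ft := uniformly_continuous_integrable (le_trans s0 st) tT Hf.
rewrite (Rintegral_segmentB s0 st ft).
have fst : lebesgue_measure.-integrable `[s, t] (EFin \o (f : measurableTypeR R -> R)).
  by apply: integrableS ft => //; apply: subset_itvr; rewrite bnd_simp.
have : (f s - e) * (t - s) <=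
    \int[lebesgue_measure]_(u in `[s, t]) f u <= (f s + e) * (t - s).
  apply: Rintegral_segment_bounds => // u su ut.
  rewrite -ler_distl; apply: H => //; first exact: le_trans tT.
  by apply: le_lt_trans td; rewrite lerD2r.
by rewrite ler_norml => /andP[h1 h2]; apply/andP; split; lra.
Qed.

(** * Left Riemann-Stieltjes sums and the Young-Loeve estimate *)

Definition left_sum (R : realType) (f g : R -> R) (m : nat) (p : nat -> R) : R :=
  \sum_(0 <= i < m) f (p i) * (g (p i.+1) - g (p i)).

Definition fine_grid (R : realType) (d u v : R) (m : nat) (p : nat -> R) :=
  [/\ p 0%N = u, p m = v & forall i, (i < m)%N -> p i < p i.+1 /\ p i.+1 - p i < d].

Lemma young_left_sum (R : realType) (f g : R -> R) (t I e : R) :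
  is_young_integral f g 0 t I -> 0 < e ->
  exists2 d : R, 0 < d & forall (m : nat) (p : nat -> R), fine_grid d 0 t m p ->
    `|left_sum f g m p - I| < e.
Proof.
move=> Iy e0; have [d d0 H] := Iy e e0; exists d => // m p [p0 pm Hp].
pose s := mkseq (p \o S) m.
have ns i : (i < m)%N -> nth 0 s i = p i.+1 by move=> im; rewrite nth_mkseq.
have n0s i : (i <= m)%N -> nth 0 (0 :: s) i = p i.
  by case: i => [|i] im //=; rewrite ns.
have sm : size s = m by rewrite size_mkseq.
have := H s p; rewrite /riemann_stieltjes_sum /left_sum big_mkord sm.
under eq_bigr => i _ do rewrite ns // n0s ?(ltnW (ltn_ord i)) //.
apply.
- split.
    apply/(pathP 0) => i; rewrite sm => im.
    by rewrite n0s ?ns ?(ltnW im) //; case: (Hp i im).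
  by rewrite (last_nth 0) sm n0s // pm.
- move=> i im; have [h1 h2] := Hp i im.
  by rewrite ns // n0s ?(ltnW im) //; split => //; rewrite lexx ltW.
Qed.

Lemma exists_fine_grid (R : realType) (d u v : R) : 0 < d -> u <= v ->
  exists m p, fine_grid d u v m p.
Proof.
move=> d0; rewrite le_eqVlt => /predU1P[->|uv].
  by exists 0%N, (fun=> v).
have [n /(_ n (leqnn _)) nd] := exists_fine_mesh (v - u) d0.
exists n.+1, (fun i => u + i%:R * ((v - u) / n.+1%:R)); split.
- by rewrite mul0r addr0.
- by rewrite mulrC divfK // addrC subrK.
- move=> i _; have -> : u + i.+1%:R * ((v - u) / n.+1%:R) =
    u + i%:R * ((v - u) / n.+1%:R) + (v - u) / n.+1%:R by rewrite -natr1; ring.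
  by rewrite ltrDl addrAC subrr add0r divr_gt0 // subr_gt0.
Qed.

(** Integrals are given from 0 only. A fixed fine grid of [0, s] is put in front of the grid of
    [s, t]; its own sum is close to [Is], and the sum over the joined grid is close to [It]. *)
Lemma young_integral_increment (R : realType) (f g : R -> R) (s t Is It e : R) :
  0 <= s -> is_young_integral f g 0 s Is -> is_young_integral f g 0 t It ->
  0 < e -> exists2 d : R, 0 < d & forall (m : nat) (p : nat -> R),
    fine_grid d s t m p -> `|left_sum f g m p - (It - Is)| <= e.
Proof.
move=> s0 HIs HIt e0; have e20 : 0 < e / 2 by rewrite divr_gt0.
have [d1 d10 H1] := young_left_sum HIs e20.
have [d2 d20 H2] := young_left_sum HIt e20.
have d0 : 0 < Num.min d1 d2 by rewrite lt_min d10.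
have [k [x [x0 xk Hx]]] := exists_fine_grid d0 s0.
exists d2 => // m p [p0 pm Hp].
pose y i := if (i < k)%N then x i else p (i - k)%N.
have yx i : (i <= k)%N -> y i = x i.
  rewrite leq_eqVlt /y => /predU1P[->|-> //].
  by rewrite ltnn subnn p0 xk.
have yp i : y (k + i)%N = p i by rewrite /y ltnNge leq_addr /= addKn.
have Hy : fine_grid d2 0 t (k + m) y.
  split; first by rewrite yx.
    by rewrite yp.
  move=> i ikm; have [ik|ki] := ltnP i k.
    rewrite (yx i (ltnW ik)) (yx i.+1 ik); have [h1] := Hx i ik.
    by rewrite lt_min => /andP[].
  rewrite -(subnKC ki) -addnS !yp; apply: Hp.
  by rewrite -(ltn_add2l k) subnKC.
have Hxs : fine_grid d1 0 s k x.
  split => // i ik; have [h1] := Hx i ik.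
  by rewrite lt_min => /andP[].
have eq : left_sum f g (k + m) y = left_sum f g k x + left_sum f g m p.
  rewrite /left_sum (big_cat_nat (n := k)) ?leq_addr //=; congr (_ + _).
    apply: eq_big_nat => i /andP[_ ik].
    by rewrite (yx i (ltnW ik)) (yx i.+1 ik).
  rewrite -{1}[k]add0n [(k + m)%N]addnC big_addn addnK; apply: eq_bigr => i _.
  by rewrite addnC -addnS !yp.
have := H1 _ _ Hxs; have := H2 _ _ Hy; rewrite eq.
move: (left_sum f g k x) (left_sum f g m p) => A B.
by rewrite !ltr_norml ler_norml => /andP[? ?] /andP[? ?]; apply/andP; split; lra.
Qed.

Lemma sum_nat_double (R : realType) (F : nat -> R) (m : nat) :
  \sum_(0 <= i < m.*2) F i = \sum_(0 <= i < m) (F i.*2 + F i.*2.+1).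
Proof.
elim: m => [|m IH]; first by rewrite !big_nil.
by rewrite doubleS !big_nat_recr //= IH addrA.
Qed.

Section young_local.
Variables (R : realType) (f g : R -> R) (T mu lam Cf Cg : R).
Hypotheses (ml : 1 < mu + lam) (Cf0 : 0 <= Cf) (Cg0 : 0 <= Cg).
Hypothesis f_holder : forall s t, 0 <= s -> s <= t -> t <= T ->
  `|f t - f s| <= Cf * (t - s) `^ mu.
Hypothesis g_holder : forall s t, 0 <= s -> s <= t -> t <= T ->
  `|g t - g s| <= Cg * (t - s) `^ lam.

Let grid s t n i : R := s + i%:R * ((t - s) / 2 ^+ n).

Let S s t n := left_sum f g (2 ^ n) (grid s t n).

(** This is 2 * 2^-(mu + lam), the factor gained by one halving: twice as many cells, each
    contributing 2^-(mu + lam) times as much. It is below 1 exactly because mu + lam > 1. *)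
Let rho : R := 2^-1 `^ (mu + lam - 1).

Let rho_ge0 : 0 <= rho. Proof. exact: powR_ge0. Qed.

Let rho_lt1 : rho < 1.
Proof.
have p0 : 0 < mu + lam - 1 by rewrite subr_gt0.
have := gt0_ltr_powR p0 (_ : 2^-1 \is Num.nneg) (_ : 1 \is Num.nneg).
by rewrite powR1 !nnegrE; apply; rewrite // invf_lt1 // ltr1n.
Qed.

Let powR_dyadic x n : 0 <= x ->
  2 ^+ n * (x / 2 ^+ n) `^ (mu + lam) = x `^ (mu + lam) * rho ^+ n.
Proof.
move=> x0; elim: n => [|n IH]; first by rewrite !expr0 divr1 mul1r mulr1.
have -> : x / 2 ^+ n.+1 = x / 2 ^+ n * 2^-1 by rewrite exprS; field; rewrite expf_neq0.
rewrite powRM ?divr_ge0 ?exprn_ge0 // -[2^-1 `^ _]mulr_powRB1 ?(lt_trans ltr01) //.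
by rewrite -/rho [2 ^+ n.+1]exprS [rho ^+ n.+1]exprS (mulrCA _ rho) -IH; field.
Qed.

(** Inserting the midpoint of a cell changes the left sum by an increment of f over the first half
    times an increment of g over the second half. *)
Let S_step s t n : 0 <= s -> s <= t -> t <= T ->
  `|S s t n.+1 - S s t n| <= Cf * Cg * (t - s) `^ (mu + lam) * rho ^+ n.
Proof.
move=> s0 st tT; have ts0 : 0 <= t - s by rewrite subr_ge0.
pose h := (t - s) / 2 ^+ n.+1; have h0 : 0 <= h by rewrite divr_ge0 // exprn_ge0.
have hS : (t - s) / 2 ^+ n = h + h by rewrite /h exprS; field; rewrite expf_neq0.
have g2 i : grid s t n.+1 i.*2 = grid s t n i.
  by rewrite /grid hS -/h -muln2 natrM; ring.
have g21 i : grid s t n.+1 i.*2.+1 = grid s t n i + h.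
  by rewrite -g2 /grid -/h -natr1; ring.
have gS i : grid s t n i.+1 = grid s t n i + h + h.
  by rewrite /grid hS -natr1; ring.
have dbl : (2 ^ n.+1 = (2 ^ n).*2)%N by rewrite expnS mul2n.
rewrite /S /left_sum dbl sum_nat_double -sumrB.
apply: (le_trans (ler_norm_sum _ _ _)).
apply: (@le_trans _ _ (\sum_(0 <= i < 2 ^ n) Cf * Cg * h `^ (mu + lam))).
  rewrite big_nat [leRHS]big_nat; apply: ler_sum => i /andP[_ i2n].
  rewrite -doubleS !g2 g21 gS; set l := grid s t n i.
  have -> : f l * (g (l + h) - g l) + f (l + h) * (g (l + h + h) - g (l + h)) -
    f l * (g (l + h + h) - g l) = (f (l + h) - f l) * (g (l + h + h) - g (l + h)) by ring.
  have l0 : 0 <= l by rewrite addr_ge0 // mulr_ge0 // hS addr_ge0.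
  have lT : l + h + h <= T.
    rewrite -gS; apply: le_trans tT; rewrite -lerBrDl.
    rewrite mulrCA ler_piMr // ler_pdivrMr ?exprn_gt0 // mul1r -natrX ler_nat //.
  have fl := f_holder l0 (_ : l <= l + h) (_ : l + h <= T).
  have gl := g_holder (_ : 0 <= l + h) (_ : l + h <= l + h + h) lT.
  rewrite normrM powRD; last by rewrite gt_eqF // (lt_trans ltr01).
  have -> : Cf * Cg * (h `^ mu * h `^ lam) = Cf * h `^ mu * (Cg * h `^ lam) by ring.
  apply: ler_pM => //.
  - have -> : h `^ mu = (l + h - l) `^ mu by rewrite addrAC subrr add0r.
    by apply: fl; rewrite ?lerDl // (le_trans _ lT) // lerDl.
  - have -> : h `^ lam = (l + h + h - (l + h)) `^ lam by rewrite [l + h + h]addrC addrK.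
    by apply: gl; rewrite ?lerDl // addr_ge0.
rewrite sumr_const_nat subn0 -mulr_natr natrX -!mulrA.
do 2 (apply: ler_wpM2l => //).
rewrite mulrC; apply: (@le_trans _ _ (2 ^+ n.+1 * h `^ (mu + lam))).
  by rewrite ler_wpM2r ?powR_ge0 // exprS ler_peMl ?exprn_ge0 // ler1n.
rewrite powR_dyadic // exprS mulrCA ler_piMl ?mulr_ge0 ?powR_ge0 ?exprn_ge0 //.
exact: ltW.
Qed.

Let S_bound s t n : 0 <= s -> s <= t -> t <= T ->
  `|S s t n - f s * (g t - g s)| <= Cf * Cg / (1 - rho) * (t - s) `^ (mu + lam).
Proof.
move=> s0 st tT; set D := Cf * Cg * (t - s) `^ (mu + lam).
have D0 : 0 <= D by rewrite !mulr_ge0 // powR_ge0.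
have r0 : 0 < 1 - rho by rewrite subr_gt0.
have -> : Cf * Cg / (1 - rho) * (t - s) `^ (mu + lam) = D / (1 - rho).
  by rewrite /D; ring.
have S0 : S s t 0 = f s * (g t - g s).
  rewrite /S /left_sum expn0 big_nat1 /grid mul0r mul1r expr0 divr1 addr0.
  by have -> : s + (t - s) = t by ring.
suff : `|S s t n - S s t 0| <= D * (1 - rho ^+ n) / (1 - rho).
  rewrite S0 => /le_trans; apply; rewrite ler_wpM2r ?invr_ge0 ?(ltW r0) //.
  by rewrite ler_piMr // gerBl exprn_ge0.
elim: n => [|n IH]; first by rewrite subrr normr0 expr0 subrr mulr0 mul0r.
have -> : S s t n.+1 - S s t 0 = (S s t n.+1 - S s t n) + (S s t n - S s t 0) by ring.
apply: (le_trans (ler_normD _ _)).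
have -> : D * (1 - rho ^+ n.+1) / (1 - rho) =
    D * rho ^+ n + D * (1 - rho ^+ n) / (1 - rho).
  by rewrite exprS; field; rewrite gt_eqF.
by apply: lerD => //; exact: S_step.
Qed.

(** The dyadic sums satisfy the bound at every level, by summing a geometric series of ratio [rho];
    as [I] is given, it only remains to take a level whose mesh brings the sum within e of the
    increment of [I]. *)
Lemma young_local_expansion (I : R -> R) :
  (forall t, 0 <= t -> t <= T -> is_young_integral f g 0 t (I t)) ->
  forall s t, 0 <= s -> s <= t -> t <= T ->
  `|I t - I s - f s * (g t - g s)| <= Cf * Cg / (1 - rho) * (t - s) `^ (mu + lam).
Proof.
move=> HI s t s0 st tT; apply/ler_addgt0Pl => e e0.
have HIs := HI s s0 (le_trans st tT); have HIt := HI t (le_trans s0 st) tT.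
have [d d0 Hd] := young_integral_increment s0 HIs HIt e0.
have [->|/eqP sNt] := eqVneq s t.
  rewrite !subrr mulr0 subr0 normr0; apply: addr_ge0; first exact: ltW.
  by rewrite !mulr_ge0 ?powR_ge0 // invr_ge0 subr_ge0 ltW.
have {}st : s < t by rewrite lt_neqAle st andbT; apply/eqP.
have [n nd] : exists n : nat, (t - s) / 2 ^+ n < d.
  have [n /(_ n (leqnn _)) H] := exists_fine_mesh (t - s) d0.
  exists n; apply: le_lt_trans H; rewrite ler_wpM2l ?subr_ge0 ?(ltW st) //.
  by rewrite lef_pV2 ?posrE ?exprn_gt0 // -natrX ler_nat ltn_expl.
have Hg : fine_grid d s t (2 ^ n) (grid s t n).
  split; rewrite /grid.
  - by rewrite mul0r addr0.
  - by rewrite natrX mulrC divfK ?expf_neq0 // addrC subrK.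
  - move=> i _; have -> : s + i.+1%:R * ((t - s) / 2 ^+ n) =
      s + i%:R * ((t - s) / 2 ^+ n) + (t - s) / 2 ^+ n by rewrite -natr1; ring.
    by rewrite ltrDl addrAC subrr add0r divr_gt0 ?subr_gt0 ?exprn_gt0.
have h1 := Hd _ _ Hg; have h2 := S_bound n s0 (ltW st) tT.
have -> : I t - I s - f s * (g t - g s) =
  - (left_sum f g (2 ^ n) (grid s t n) - (I t - I s)) + (S s t n - f s * (g t - g s)).
  by rewrite /S; ring.
by rewrite (le_trans (ler_normD _ _)) // normrN lerD.
Qed.

End young_local.

(** * Young equations and ordinary equations *)

Lemma holder_uniformly_continuous (R : realType) (lam T : R) (f : R -> R) :
  0 < lam -> holder_on lam 0 T f -> uniformly_continuous_upto T f.
Proof.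
move=> lam0 [C HC] e e0; have [d d0 H] := powR_le_near0 C lam0 e0.
exists d => // s t s0 st tT td; have ts0 : 0 <= t - s by rewrite subr_ge0.
have := HC s t; rewrite !in_itv /= s0 (le_trans st tT) (le_trans s0 st) tT.
move=> /(_ isT isT)/le_trans; apply.
by rewrite ger0_norm //; apply: H => //; exact: ltW.
Qed.

Lemma holder_bounded (R : realType) (lam T : R) (f : R -> R) :
  0 <= T -> 0 <= lam -> holder_on lam 0 T f ->
  exists2 M : R, 0 <= M & forall t, 0 <= t -> t <= T -> `|f t| <= M.
Proof.
move=> T0 lam0 [C HC]; exists (`|f 0| + `|C| * T `^ lam).
  by rewrite addr_ge0 // mulr_ge0 // powR_ge0.
move=> t t0 tT; have := HC 0 t; rewrite !in_itv /= lexx T0 t0 tT subr0.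
move=> /(_ isT isT) h; have -> : f t = f 0 + (f t - f 0) by ring.
apply: (le_trans (ler_normD _ _)); rewrite lerD2l (le_trans h) //.
rewrite ger0_norm //; apply: (@le_trans _ _ (`|C| * t `^ lam)).
  by rewrite ler_wpM2r ?powR_ge0 // ler_norm.
by rewrite ler_wpM2l // ge0_ler_powR.
Qed.

(* [dy = f dt + sigma(y) dz], read off increments. *)
Definition sde_local (R : realType) (f sigma z : R -> R) (T : R) (y : R -> R) :=
  forall e : R, 0 < e -> exists2 d : R, 0 < d &
    forall s t : R, 0 <= s -> s <= t -> t <= T -> t - s < d ->
    `|y t - y s - f s * (t - s) - sigma (y s) * (z t - z s)| <= e * (t - s).

Lemma sde_local_of_young (R : realType) (f sigma z y : R -> R) (T L mu lam x0 : R) :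
  1 < mu + lam -> 0 <= L ->
  (forall x x', `|sigma x - sigma x'| <= L * `|x - x'|) ->
  holder_on mu 0 T y -> holder_on lam 0 T z -> uniformly_continuous_upto T f ->
  (forall t, 0 <= t -> t <= T -> exists2 I, is_young_integral (sigma \o y) z 0 t I &
     y t = x0 + \int[lebesgue_measure]_(s in `[0, t]) f s + I) ->
  sde_local f sigma z T y.
Proof.
move=> ml L0 sL [Cy Hy] [Cz Hz] Hf Hsol e e0.
pose J t : R := \int[lebesgue_measure]_(s in `[0, t]) f s.
(* The equation provides an integral separately for each t; solving for it gives a function of t. *)
pose I t := y t - x0 - J t.
have HI t : 0 <= t -> t <= T -> is_young_integral (sigma \o y) z 0 t (I t).
  move=> t0 tT; have [I' HI' yt] := Hsol t t0 tT.
  suff -> : I t = I' by [].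
  by rewrite /I yt -/(J t); ring.
have e20 : 0 < e / 2 by rewrite divr_gt0.
have [d1 d10 H1] := Rintegral_expansion Hf e20.
have sy s t : 0 <= s -> s <= t -> t <= T ->
    `|(sigma \o y) t - (sigma \o y) s| <= L * `|Cy| * (t - s) `^ mu.
  move=> s0 st tT; apply: (le_trans (sL _ _)); rewrite -mulrA ler_wpM2l //.
  have := Hy s t; rewrite !in_itv /= s0 (le_trans st tT) (le_trans s0 st) tT.
  move=> /(_ isT isT)/le_trans; apply; rewrite ger0_norm ?subr_ge0 //.
  by rewrite ler_wpM2r ?powR_ge0 // ler_norm.
have hz s t : 0 <= s -> s <= t -> t <= T -> `|z t - z s| <= `|Cz| * (t - s) `^ lam.
  move=> s0 st tT.
  have := Hz s t; rewrite !in_itv /= s0 (le_trans st tT) (le_trans s0 st) tT.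
  move=> /(_ isT isT)/le_trans; apply; rewrite ger0_norm ?subr_ge0 //.
  by rewrite ler_wpM2r ?powR_ge0 // ler_norm.
have HC := young_local_expansion ml (mulr_ge0 L0 (normr_ge0 Cy)) (normr_ge0 Cz) sy hz HI.
set C := _ / (1 - _) in HC.
have [d2 d20 H2] := powR_superlinear_near0 C ml e20.
exists (Num.min d1 d2); first by rewrite lt_min d10.
move=> s t s0 st tT; rewrite lt_min => /andP[td1 td2].
have ts0 : 0 <= t - s by rewrite subr_ge0.
have h1 := H1 s t s0 st tT td1.
have h2 := le_trans (HC s t s0 st tT) (H2 _ ts0 (ltW td2)).
have -> : y t - y s - f s * (t - s) - sigma (y s) * (z t - z s) =
  (J t - J s - f s * (t - s)) + (I t - I s - sigma (y s) * (z t - z s)).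
  by rewrite /I; ring.
apply: (le_trans (ler_normD _ _)); rewrite [e](splitr e) mulrDl.
exact: lerD.
Qed.

(** The integral is not constructed but read off the equation: summing the local expansions
    telescopes to the increment of y minus the drift integral. Moving a tag off the left end costs L
    |dy| |dz|, which is at most L (dy^2 + dz^2) / 2. *)
Lemma young_of_sde_local (R : realType) (f sigma z y : R -> R) (T L : R) :
  0 <= L -> (forall x x', `|sigma x - sigma x'| <= L * `|x - x'|) ->
  small_squares T y -> small_squares T z -> uniformly_continuous_upto T f ->
  sde_local f sigma z T y ->
  forall t, 0 <= t -> t <= T -> is_young_integral (sigma \o y) z 0 t
    (y t - y 0 - \int[lebesgue_measure]_(s in `[0, t]) f s).
Proof.
move=> L0 sL Hy Hz Hf Hsol t t0 tT e e0.
pose J u : R := \int[lebesgue_measure]_(s in `[0, u]) f s.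
have J0 : J 0 = 0 by rewrite /J set_itv1 Rintegral_set1.
(* A cell costs L k for the tag, k for the local equation and k for the drift integral, times its
   length; t + 1 in place of t makes the total strictly less than e. *)
have c0 : 0 < (t + 1) * (L + 2).
  by rewrite mulr_gt0 // ltr_wpDl.
pose k := e / ((t + 1) * (L + 2)).
have k0 : 0 < k by rewrite divr_gt0.
have [d1 d10 H1] := Rintegral_expansion Hf k0.
have [d2 d20 H2] := Hy k k0; have [d3 d30 H3] := Hz k k0.
have [d4 d40 H4] := Hsol k k0.
exists (Num.min (Num.min d1 d2) (Num.min d3 d4)); first by rewrite !lt_min d10 d20 d30 d40.
move=> s tag [sp /eqP sl] Htag.
pose p i := nth 0 (0 :: s) i.
have ps i : (i < size s)%N -> p i <= p i.+1.
  by move=> im; apply: ltW; move/(pathP 0): sp => /(_ i im).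
have p_mono i j : (i <= j)%N -> (j <= size s)%N -> p i <= p j.
  elim: j => [|j IH]; first by rewrite leqn0 => /eqP ->.
  rewrite leq_eqVlt => /predU1P[-> //|ij jm].
  exact: le_trans (IH ij (ltnW jm)) (ps j jm).
have pt : p (size s) = t by rewrite /p -last_nth.
have -> : y t - y 0 - J t =
    \sum_(i < size s) ((y (p i.+1) - J (p i.+1)) - (y (p i) - J (p i))).
  rewrite -(big_mkord xpredT (fun i => (y (p i.+1) - J (p i.+1)) - (y (p i) - J (p i)))).
  rewrite (telescope_sumr (fun i => y (p i) - J (p i))) // pt /p /= J0 /J; ring.
rewrite /riemann_stieltjes_sum -sumrB.
apply: le_lt_trans (ler_norm_sum _ _ _) _.
apply: (@le_lt_trans _ _ (\sum_(i < size s) (L + 2) * k * (p i.+1 - p i))).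
  apply: ler_sum => i _; have im := ltn_ord i.
  have [] := Htag i im; rewrite -/(p i) -/(p i.+1) !lt_min.
  move=> /andP[/andP[i1 i2] /andP[i3 i4]] /andP[t1 t2].
  have p0 : 0 <= p i by exact: (p_mono 0%N i (leq0n _) (ltnW im)).
  have pS : p i <= p i.+1 := ps i im.
  have pT : p i.+1 <= T.
    by apply: le_trans tT; rewrite -pt; exact: p_mono.
  have dp0 : 0 <= p i.+1 - p i by rewrite subr_ge0.
  have h1 := H1 _ _ p0 pS pT i1; have h3 := H3 _ _ p0 pS pT i3.
  have h4 := H4 _ _ p0 pS pT i4.
  have dtag : tag i - p i <= p i.+1 - p i by rewrite lerD2r.
  have h2 := H2 _ _ p0 t1 (le_trans t2 pT) (le_lt_trans dtag i2).
  rewrite -/(J _) -/(J _) in h1.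
  set ds := sigma (y (tag i)) - sigma (y (p i)).
  set dz := z (p i.+1) - z (p i) in h3 h4 *.
  have h5 : `|ds * dz| <= L * (k * (p i.+1 - p i)).
    rewrite normrM; apply: (@le_trans _ _ (L * `|y (tag i) - y (p i)| * `|dz|)).
      by rewrite ler_wpM2r // sL.
    rewrite -mulrA ler_wpM2l //.
    have {}h2 : (y (tag i) - y (p i)) ^+ 2 <= k * (p i.+1 - p i).
      by apply: (le_trans h2); rewrite ler_wpM2l // ltW.
    move: h2 h3; rewrite -(real_normK (num_real (y (tag i) - _))).
    rewrite -(real_normK (num_real dz)).
    by move: `|_| `|_| => A B; have := sqr_ge0 (A - B); nra.
  have -> : (sigma \o y) (tag i) * dz - (y (p i.+1) - J (p i.+1) - (y (p i) - J (p i))) =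
    ds * dz - (y (p i.+1) - y (p i) - f (p i) * (p i.+1 - p i) - sigma (y (p i)) * dz)
     + (J (p i.+1) - J (p i) - f (p i) * (p i.+1 - p i)).
    by rewrite /ds /=; ring.
  apply: (le_trans (ler_normD _ _)).
  apply: (le_trans (lerD (ler_normB _ _) (lexx _))).
  by lra.
rewrite -mulr_sumr -(big_mkord xpredT (fun i => p i.+1 - p i)) telescope_sumr // pt subr0.
rewrite /k; have -> : (L + 2) * (e / ((t + 1) * (L + 2))) * t = e * (t / (t + 1)).
  by field; rewrite !gt_eqF // ltr_wpDl.
by rewrite gtr_pMr // ltr_pdivrMr ?mul1r ?ltrDl // ltr_wpDl.
Qed.

Section lamperti_transform.
Variables (R : realType) (sigma : R -> R) (s0 L : R).
Hypotheses (s0_gt0 : 0 < s0) (sigma_ge : forall x, s0 <= sigma x).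
Hypothesis sigma_lip : forall x y, `|sigma x - sigma y| <= L * `|x - y|.

Let G := lamperti sigma.
Let psi := lamperti_inv sigma.

Let sigma_gt0 x : 0 < sigma x. Proof. exact: lt_le_trans (sigma_ge x). Qed.

Let c := L / s0 ^+ 2.

Let c0 : 0 <= c.
Proof.
have L0 : 0 <= L by have := sigma_lip 1 0; rewrite subr0 normr1 mulr1; exact: le_trans.
by rewrite divr_ge0 // exprn_ge0 // ltW.
Qed.

(** After division by sigma the increment of z cancels. The rate is prescribed only along the path,
    so a truncated rate is allowed wherever the path does not meet the truncation. *)
Lemma ode_of_sde_local (f z y : R -> R) (T : R) (r : R -> R -> R) :
  small_squares T y -> sde_local f sigma z T y ->
  (forall s, 0 <= s -> s <= T -> r s (G (y s) - z s) = f s / sigma (y s)) ->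
  ode_solution r T (fun t => G (y t) - z t).
Proof.
move=> Hy Hsol Hr e e0.
have k0 : 0 < e / 2 / (c + 1) by rewrite !divr_gt0 // ltr_wpDl.
have l0 : 0 < e / 2 * s0 by rewrite mulr_gt0 // divr_gt0.
have [d1 d10 H1] := Hy _ k0; have [d2 d20 H2] := Hsol _ l0.
exists (Num.min d1 d2); first by rewrite lt_min d10.
move=> s t s_ge0 st tT; rewrite lt_min => /andP[td1 td2].
have ts0 : 0 <= t - s by rewrite subr_ge0.
have h1 := H1 s t s_ge0 st tT td1; have h2 := H2 s t s_ge0 st tT td2.
have h3 := lamperti_expansion s0_gt0 sigma_ge sigma_lip (y s) (y t).
rewrite -/G -/c in h3; rewrite Hr // ?(le_trans st) //.
set E := y t - y s - f s * (t - s) - sigma (y s) * (z t - z s) in h2.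
have -> : G (y t) - z t - (G (y s) - z s) - f s / sigma (y s) * (t - s) =
  (G (y t) - G (y s) - (y t - y s) / sigma (y s)) + E / sigma (y s).
  by rewrite /E; field; rewrite gt_eqF.
apply: (le_trans (ler_normD _ _)); rewrite [e](splitr e) [leRHS]mulrDl; apply: lerD.
  apply: (le_trans h3); apply: (@le_trans _ _ ((c + 1) * (e / 2 / (c + 1) * (t - s)))).
    by apply: ler_pM; rewrite ?sqr_ge0 ?lerDl.
  rewrite le_eqVlt; apply/orP; left; apply/eqP; field.
  by rewrite gt_eqF // ltr_wpDl.
rewrite normrM normfV (gtr0_norm (sigma_gt0 _)) ler_pdivrMr //.
apply: (le_trans h2); rewrite mulrAC -!mulrA.
rewrite ler_wpM2l ?(ltW e0) // ler_wpM2l ?invr_ge0 // ler_wpM2l //.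
Qed.

(** The same expansion multiplied back by sigma, whose size along the path, [D], therefore enters
    the error. *)
Lemma sde_local_of_ode (f z V : R -> R) (T D : R) (r : R -> R -> R) :
  let y t := psi (V t + z t) in
  small_squares T y -> (forall s, 0 <= s -> s <= T -> sigma (y s) <= D) ->
  (forall s, 0 <= s -> s <= T -> r s (V s) = f s / sigma (y s)) ->
  ode_solution r T V -> sde_local f sigma z T y.
Proof.
move=> y Hy HD Hr HV e e0.
have [T0|T0] := leP 0 T; last first.
  exists 1 => // s t s_ge0 st tT _.
  by have := le_trans (le_trans s_ge0 st) tT; rewrite leNgt T0.
have D0 : 0 < D by apply: lt_le_trans (HD 0 (lexx _) T0).
have k0 : 0 < e / 2 / (D * (c + 1)) by rewrite !divr_gt0 // mulr_gt0 // ltr_wpDl.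
have l0 : 0 < e / 2 / D by rewrite !divr_gt0.
have [d1 d10 H1] := Hy _ k0; have [d2 d20 H2] := HV _ l0.
exists (Num.min d1 d2); first by rewrite lt_min d10.
move=> s t s_ge0 st tT; rewrite lt_min => /andP[td1 td2].
have ts0 : 0 <= t - s by rewrite subr_ge0.
have sT := le_trans st tT.
have h1 := H1 s t s_ge0 st tT td1; have h2 := H2 s t s_ge0 st tT td2.
rewrite Hr // in h2.
have h3 := lamperti_expansion s0_gt0 sigma_ge sigma_lip (y s) (y t).
have Gy u : lamperti sigma (y u) = V u + z u.
  exact: (lamperti_invK s0_gt0 sigma_ge sigma_lip).
rewrite !Gy -/c in h3.
set A := V t + z t - (V s + z s) - (y t - y s) / sigma (y s) in h3.
set B := V t - V s - f s / sigma (y s) * (t - s) in h2.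
have -> : y t - y s - f s * (t - s) - sigma (y s) * (z t - z s) = sigma (y s) * (B - A).
  by rewrite /A /B; field; rewrite gt_eqF.
rewrite normrM (gtr0_norm (sigma_gt0 _)).
apply: (@le_trans _ _ (D * (`|B| + `|A|))).
  by apply: ler_pM => //; [exact: ltW|exact: HD|exact: ler_normB].
rewrite mulrDr [e](splitr e) [leRHS]mulrDl; apply: lerD.
  by rewrite mulrC -ler_pdivlMr // mulrAC.
rewrite mulrC -ler_pdivlMr // (le_trans h3) //.
apply: (@le_trans _ _ ((c + 1) * (e / 2 / (D * (c + 1)) * (t - s)))).
  by apply: ler_pM; rewrite ?sqr_ge0 ?lerDl.
rewrite le_eqVlt; apply/orP; left; apply/eqP; field.
by rewrite !gt_eqF // ltr_wpDl.
Qed.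

End lamperti_transform.

(** * The flow of the Young equation *)

Lemma ode_solution_ext (R : realType) (r r' : R -> R -> R) (T : R) (V W : R -> R) :
  (forall s, 0 <= s -> s <= T -> V s = W s) ->
  (forall s, 0 <= s -> s <= T -> r s (V s) = r' s (V s)) ->
  ode_solution r T V -> ode_solution r' T W.
Proof.
move=> VW rr' HV e e0; have [d d0 H] := HV e e0; exists d => // s t s0 st tT td.
have sT := le_trans st tT; have t0 := le_trans s0 st.
by rewrite -!VW // -rr' // H.
Qed.

Lemma ode_solution_opp (R : realType) (r : R -> R -> R) (T : R) (V : R -> R) :
  ode_solution r T V -> ode_solution (fun s v => - r s (- v)) T (fun s => - V s).
Proof.
move=> HV e e0; have [d d0 H] := HV e e0; exists d => // s t s0 st tT td.
rewrite -normrN.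
have -> : - (- V t - - V s - - r s (- - V s) * (t - s)) = V t - V s - r s (V s) * (t - s).
  by rewrite opprK; ring.
exact: H.
Qed.

(* The truncation makes the rate bounded and Lipschitz; by mean reversion the
   solution does not see it once [M] is large. *)
Definition lamperti_rate (R : realType) (sigma : R -> R) (drift : R -> R -> R)
    (z : R -> R) (M s v : R) : R :=
  let x := lamperti_inv sigma (clamp (- M) M (v + z s)) in drift s x / sigma x.

Definition truncated_flow (R : realType) (sigma : R -> R) (drift : R -> R -> R)
    (T x0 : R) (z : R -> R) (M : R) : R -> R :=
  euler_limit (lamperti_rate sigma drift z M) T (lamperti sigma x0 - z 0).

Definition sde_flow (R : realType) (sigma : R -> R) (drift : R -> R -> R)
    (T x0 : R) (z : R -> R) (t : R) : R :=
  lamperti_inv sigma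
    (limn (fun n => truncated_flow sigma drift T x0 z n%:R t) + z t).

Section sde_flow.
Variables (R : realType) (sigma : R -> R) (s0 L : R).
Hypotheses (s0_gt0 : 0 < s0) (sigma_ge : forall x, s0 <= sigma x).
Hypothesis sigma_lip : forall x y, `|sigma x - sigma y| <= L * `|x - y|.
Variables (drift : R -> R -> R) (A beta xm xp : R).
Hypothesis drift_lip : forall s s' x x',
  `|drift s x - drift s' x'| <= A * (`|s - s'| + `|x - x'|).
Hypothesis drift_bounded : forall s, `|drift s 0| <= beta.
Hypothesis drift_le0 : forall s x, xp <= x -> drift s x <= 0.
Hypothesis drift_ge0 : forall s x, x <= xm -> 0 <= drift s x.

Let G := lamperti sigma.
Let psi := lamperti_inv sigma.

Let sigma_gt0 x : 0 < sigma x. Proof. exact: lt_le_trans (sigma_ge x). Qed.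

Let L0 : 0 <= L.
Proof. by have := sigma_lip 1 0; rewrite subr0 normr1 mulr1; exact: le_trans. Qed.

Let A0 : 0 <= A.
Proof.
have := drift_lip 0 0 1 0; rewrite subrr normr0 add0r subr0 normr1 mulr1.
exact: le_trans.
Qed.

Let beta0 : 0 <= beta. Proof. exact: le_trans (drift_bounded 0). Qed.

(** In time the rate inherits the modulus of continuity of z. [K] does not depend on z, which
    permits replacing z by 0 when proving measurability. *)
Lemma lamperti_rate_bounds M : 0 <= M -> exists2 K : R, 0 <= K &
  forall z u u' v w, `|lamperti_rate sigma drift z M u v| <= K /\
  `|lamperti_rate sigma drift z M u v - lamperti_rate sigma drift z M u' w| <=
     K * (`|u - u'| + (`|v - w| + `|z u - z u'|)).
Proof.
move=> M0; have [D D0 HD] := lamperti_inv_lip s0_gt0 sigma_ge sigma_lip M.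
have D_ge0 := ltW D0; have i0 : 0 <= s0^-1 by rewrite invr_ge0 ltW.
have c0 : 0 <= L / s0 ^+ 2 by rewrite divr_ge0 // exprn_ge0 // ltW.
pose B := beta + A * D; have B0 : 0 <= B by rewrite addr_ge0 // mulr_ge0.
(* [K1], [K2] and [K3] are the constants in time, in the state and in supremum norm; [B] bounds the
   drift on [-D, D], and [D] in [K2] comes from the inverse transform. *)
pose K1 := A * s0^-1; have K10 : 0 <= K1 by rewrite mulr_ge0.
pose K2 := A * D * s0^-1 + B * (L / s0 ^+ 2 * D).
have K20 : 0 <= K2.
  by apply: addr_ge0; apply: mulr_ge0 => //; apply: mulr_ge0.
pose K3 := B * s0^-1; have K30 : 0 <= K3 by rewrite mulr_ge0.
have MM : - M <= M by lra.
have K12 : 0 <= K1 + K2 by exact: addr_ge0.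
exists (K1 + K2 + K3); first exact: addr_ge0.
move=> z u u' v w; rewrite /lamperti_rate.
set p := clamp _ _ _; set p' := clamp _ _ (w + _).
have pM : `|p| <= M by rewrite ler_norml clamp_itv.
have pM' : `|p'| <= M by rewrite ler_norml clamp_itv.
have pp' : `|p - p'| <= `|v - w| + `|z u - z u'|.
  apply: (le_trans (clamp_lip _ _ _ _)).
  have -> : v + z u - (w + z u') = (v - w) + (z u - z u') by ring.
  exact: ler_normD.
have [xD sxD xx'] := HD p p' pM pM'; have [xD' sxD' _] := HD p' p pM' pM.
rewrite -/psi in xD sxD xx' xD' sxD' *.
move: (psi p) (psi p') xD sxD xx' xD' sxD' => x x' xD sxD xx' xD' sxD'.
have dB s y : `|y| <= D -> `|drift s y| <= B.
  move=> yD; have -> : drift s y = drift s 0 + (drift s y - drift s 0) by ring.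
  rewrite (le_trans (ler_normD _ _)) // lerD // (le_trans (drift_lip _ _ _ _)) //.
  by rewrite subrr normr0 add0r subr0 ler_wpM2l.
have si y : `|(sigma y)^-1| <= s0^-1.
  by rewrite normfV gtr0_norm // lef_pV2 ?posrE.
split.
  apply: (@le_trans _ _ K3); last by rewrite lerDr.
  by rewrite normrM; apply: ler_pM => //; exact: dB.
have -> : drift u x / sigma x - drift u' x' / sigma x' =
  (drift u x - drift u' x') / sigma x + drift u' x' * ((sigma x)^-1 - (sigma x')^-1).
  by ring.
apply: (le_trans (ler_normD _ _)); rewrite !normrM.
set U := `|u - u'|; set P := `|v - w| + _ in pp' *.
have U0 : 0 <= U by exact: normr_ge0.
have P0 : 0 <= P by exact: addr_ge0.
have h1 : `|x - x'| <= D * P by rewrite (le_trans xx') // ler_wpM2l.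
have h2 : `|drift u x - drift u' x'| * `|(sigma x)^-1| <= A * (U + D * P) * s0^-1.
  apply: ler_pM => //; apply: (le_trans (drift_lip _ _ _ _)).
  by rewrite ler_wpM2l // lerD2l.
have h3 : `|drift u' x'| * `|(sigma x)^-1 - (sigma x')^-1| <= B * (L / s0 ^+ 2 * (D * P)).
  apply: ler_pM => //; first exact: dB.
  apply: (le_trans (inv_sigma_lip s0_gt0 sigma_ge sigma_lip _ _)).
  by rewrite ler_wpM2l.
apply: (le_trans (lerD h2 h3)).
apply: (@le_trans _ _ (K1 * U + K2 * P)); last first.
  have : 0 <= (K2 + K3) * U + (K1 + K3) * P.
    by apply: addr_ge0; apply: mulr_ge0 => //; exact: addr_ge0.
  by lra.
by rewrite /K1 /K2 le_eqVlt; apply/orP; left; apply/eqP; ring.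
Qed.

Variables (T x0 zeta : R) (z : R -> R).
Hypotheses (T0 : 0 < T) (z_bounded : forall t, `|z t| <= zeta).
Hypothesis z_unif : forall e : R, 0 < e -> exists2 d : R, 0 < d &
  forall s t, `|s - t| < d -> `|z s - z t| <= e.

Let rate := lamperti_rate sigma drift z.

Let rate_lip M : 0 <= M -> exists2 K : R, 0 <= K &
  forall u v w, `|rate M u v - rate M u w| <= K * `|v - w|.
Proof.
move=> /lamperti_rate_bounds[K K0 H]; exists K => // u v w.
by have [_] := H z u u v w; rewrite !subrr !normr0 addr0 add0r.
Qed.

Let rate_unif M : 0 <= M -> forall e : R, 0 < e -> exists2 d : R, 0 < d &
  forall u u' v, `|u - u'| <= d -> `|rate M u v - rate M u' v| <= e.
Proof.
move=> /lamperti_rate_bounds[K K0 H] e e0.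
have k0 : 0 < e / 2 / (K + 1) by rewrite !divr_gt0 // ltr_wpDl.
have [d d0 Hd] := z_unif k0.
exists (Num.min (d / 2) (e / 2 / (K + 1))); first by rewrite lt_min divr_gt0.
move=> u u' v; rewrite le_min => /andP[h1 h2].
have h3 : `|z u - z u'| <= e / 2 / (K + 1) by apply: Hd; lra.
have [_] := H z u u' v v; rewrite subrr normr0 add0r => /le_trans; apply.
apply: (@le_trans _ _ ((K + 1) * (e / 2 / (K + 1) + e / 2 / (K + 1)))).
  by apply: ler_pM; rewrite ?lerDl ?addr_ge0 // lerD.
rewrite le_eqVlt; apply/orP; left; apply/eqP; field.
by rewrite gt_eqF // ltr_wpDl.
Qed.

Let V := truncated_flow sigma drift T x0 z.

Lemma truncated_flow0 M : V M 0 = G x0 - z 0.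
Proof. exact: euler_limit0. Qed.

Lemma truncated_flow_solution M : 0 <= M -> ode_solution (rate M) T (V M).
Proof.
move=> M0; have [K K0 H] := lamperti_rate_bounds M0.
have [K' K'0 HK'] := rate_lip M0.
apply: (@euler_limit_solution _ _ K K' T _ K'0 T0 _ HK' (rate_unif M0)) => u v.
by have [] := H z u u v v.
Qed.

Lemma truncated_flow_lip M : 0 <= M -> exists2 B : R, 0 <= B &
  forall s t, 0 <= s -> s <= t -> t <= T -> `|V M t - V M s| <= B * (t - s).
Proof.
move=> M0; have [K K0 H] := lamperti_rate_bounds M0.
have [K' K'0 HK'] := rate_lip M0.
exists K => //.
apply: (@euler_limit_lipschitz _ _ K K' T _ K'0 T0 _ HK' (rate_unif M0)) => u v.
by have [] := H z u u v v.
Qed.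

Lemma cvg_truncated_flow M t : 0 <= M -> 0 <= t -> t <= T ->
  cvgn (fun n => euler (rate M) (G x0 - z 0) (T / n.+1%:R) n.+1 t).
Proof.
move=> M0; have [K K0 H] := lamperti_rate_bounds M0.
have [K' K'0 HK'] := rate_lip M0.
apply: (@cvg_euler_limit _ _ K K' T _ K'0 T0 _ HK' (rate_unif M0)) => u v.
by have [] := H z u u v v.
Qed.

(** Once |V| exceeds the sum without the last [zeta], V + z lies beyond [G xp] or [G xm], where the
    drift points inwards; the last [zeta] passes from V to V + z. *)
Let M0 := `|G x0 - z 0| + `|G xp| + `|G xm| + zeta + zeta.

Let zeta0 : 0 <= zeta. Proof. exact: le_trans (z_bounded 0). Qed.

Let M0_ge0 : 0 <= M0. Proof. by rewrite !addr_ge0. Qed.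

Let truncated_flow_bound M t : M0 <= M -> 0 <= t -> t <= T -> `|V M t + z t| <= M0.
Proof.
move=> M0M t0 tT; have Mge0 := le_trans M0_ge0 M0M.
have [K K0 HK] := rate_lip Mge0.
have VM := truncated_flow_solution Mge0.
pose m := `|G x0 - z 0| + `|G xp| + `|G xm| + zeta.
have n0 : 0 <= `|G x0 - z 0| by [].
have n1 : 0 <= `|G xp| by []. have n2 : 0 <= `|G xm| by [].
have GM x : `|G x| <= `|G xp| + `|G xm| -> - M <= G x /\ G x <= M.
  move=> Gx; have : `|G x| <= M.
    by move: M0M zeta0; rewrite /M0; lra.
  by rewrite ler_norml => /andP[].
have zb s : - zeta <= z s <= zeta by rewrite -ler_norml.
have ub : V M t <= m.
  apply: (ode_solution_ub K0 HK _ VM) => //; last first.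
    by rewrite truncated_flow0 (le_trans (ler_norm _)) // /m -!addrA lerDl !addr_ge0.
  move=> s v mv; rewrite /rate /lamperti_rate.
  have [g1 g2] := GM xp (ltac:(lra)).
  set p := clamp _ _ _.
  (* A level above |G xp| leaves [G xp] fixed, so clamping keeps the argument on the side where the
     drift is nonpositive. *)
  have Gp : G xp <= p.
    rewrite -(clamp_id g1 g2); apply: clamp_le_mono.
    have := zb s; have := ler_norm (G xp).
    by move: mv; rewrite /m => ? ? /andP[]; lra.
  rewrite pmulr_lle0 ?invr_gt0 //; apply: drift_le0.
  rewrite -(lampertiK s0_gt0 sigma_ge sigma_lip xp).
  by rewrite (lamperti_inv_le s0_gt0 sigma_ge sigma_lip).
have lb : - V M t <= m.
  apply: (ode_solution_ub K0 _ _ (ode_solution_opp VM)) => //; last first.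
  - by rewrite truncated_flow0 (le_trans (ler_norm _)) // normrN /m -!addrA lerDl !addr_ge0.
  - move=> s v mv; rewrite oppr_le0 /rate /lamperti_rate.
    have [g1 g2] := GM xm (ltac:(lra)).
    set p := clamp _ _ _.
    have Gp : p <= G xm.
      rewrite -(clamp_id g1 g2); apply: clamp_le_mono.
      have := zb s; have := lerNnormlW (lexx `|G xm|).
      by move: mv; rewrite /m => ? ? /andP[]; lra.
    rewrite mulr_ge0 // ?invr_ge0 ?(ltW (sigma_gt0 _)) //; apply: drift_ge0.
    rewrite -(lampertiK s0_gt0 sigma_ge sigma_lip xm).
    by rewrite (lamperti_inv_le s0_gt0 sigma_ge sigma_lip).
  - move=> s v w; rewrite -opprD normrN; apply: (le_trans (HK _ _ _)).
    by rewrite -opprD normrN.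
have /andP[z1 z2] := zb t.
rewrite ler_norml; have -> : M0 = m + zeta by [].
by apply/andP; split; lra.
Qed.

Let rate_untruncated M M' s v : `|v + z s| <= M -> `|v + z s| <= M' ->
  rate M s v = rate M' s v.
Proof.
rewrite !ler_norml => /andP[a1 a2] /andP[b1 b2].
by rewrite /rate /lamperti_rate !clamp_id.
Qed.

(** The flow at level [n0] stays below [n0], so it also solves the equation at every higher level,
    where uniqueness applies. *)
Lemma truncated_flow_stable : exists2 n0 : nat,
  (forall t, 0 <= t -> t <= T -> `|V n0%:R t + z t| <= n0%:R) &
  forall n t, (n0 <= n)%N -> 0 <= t -> t <= T -> V n%:R t = V n0%:R t.
Proof.
pose n0 := (Num.trunc M0).+1.
have Mn0 : M0 <= n0%:R by rewrite ltW // truncnS_gt.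
exists n0; first by move=> t t0 tT; apply: (le_trans _ Mn0); exact: truncated_flow_bound.
move=> n t n0n t0 tT; have Mn : M0 <= n%:R by rewrite (le_trans Mn0) // ler_nat.
have [K K0 HK] := rate_lip (ler0n R n).
apply: (@ode_solution_unique _ _ T K (V n%:R) (V n0%:R) K0 HK) => //.
- by apply: truncated_flow_solution.
- apply: (ode_solution_ext _ _ (truncated_flow_solution (ler0n R n0))) => // s s_ge0 sT.
  have := truncated_flow_bound Mn0 s_ge0 sT => H.
  by apply: rate_untruncated; apply: (le_trans H).
- by rewrite !truncated_flow0.
Qed.

Lemma cvg_truncated_flow_nat t : 0 <= t -> t <= T -> cvgn (fun n => V n%:R t).
Proof.
have [n0 _ H] := truncated_flow_stable => t0 tT.
apply: (@cvgP _ _ (V n0%:R t)); apply: cvg_near_cst.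
by exists n0 => // n /= n0n; rewrite H.
Qed.

Let X := sde_flow sigma drift T x0 z.

Let flow_eq : exists2 n0 : nat,
  (forall t, 0 <= t -> t <= T -> `|V n0%:R t + z t| <= n0%:R) &
  forall t, 0 <= t -> t <= T -> X t = psi (V n0%:R t + z t).
Proof.
have [n0 H1 H2] := truncated_flow_stable; exists n0 => // t t0 tT.
congr (psi (_ + _)); apply: cvg_lim => //; apply: cvg_near_cst.
by exists n0 => // n /= n0n; exact: H2.
Qed.

Lemma sde_flow0 : X 0 = x0.
Proof.
have [n0 _ ->] := flow_eq; rewrite ?(ltW T0) // truncated_flow0 subrK.
exact: (lampertiK s0_gt0 sigma_ge sigma_lip).
Qed.

Lemma sde_flow_holder lam : 0 < lam -> lam < 1 -> holder_on lam 0 T z ->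
  holder_on lam 0 T X.
Proof.
move=> lam0 lam1 [C HC]; have [n0 H1 H2] := flow_eq.
have [D D0 HD] := lamperti_inv_lip s0_gt0 sigma_ge sigma_lip n0%:R.
have [B B0 HB] := truncated_flow_lip (ler0n R n0).
(* The factor T^(1 - lam) turns the Lipschitz bound on V into a bound of exponent lam on an interval
   of length T. *)
exists (D * (B * T `^ (1 - lam) + C)) => s t.
rewrite !in_itv /= => /andP[s_ge0 sT] /andP[t0 tT]; rewrite !H2 //.
have [_ _ h] := HD _ _ (H1 t t0 tT) (H1 s s_ge0 sT).
apply: (le_trans h); rewrite -mulrA ler_wpM2l ?(ltW D0) //.
have -> : V n0%:R t + z t - (V n0%:R s + z s) =
    (V n0%:R t - V n0%:R s) + (z t - z s) by ring.
apply: (le_trans (ler_normD _ _)); rewrite mulrDl; apply: lerD; last first.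
  by apply: HC; rewrite in_itv /= ?s_ge0 ?t0.
apply: (@le_trans _ _ (B * `|t - s|)).
  have [st|/ltW ts] := leP s t.
    by rewrite (ger0_norm (_ : 0 <= t - s)) ?subr_ge0 // HB.
  by rewrite distrC [`|t - s|]distrC (ger0_norm (_ : 0 <= s - t)) ?subr_ge0 // HB.
rewrite -mulrA ler_wpM2l //.
have [->|ts] := eqVneq (t - s) 0; first by rewrite normr0 mulr_ge0 // powR_ge0.
have {}ts : 0 < `|t - s| by rewrite normr_gt0.
rewrite -{1}(powRr1 (ltW ts)) -{1}(subrK lam 1) powRD; last by rewrite subrK oner_eq0.
rewrite ler_wpM2r ?powR_ge0 // ge0_ler_powR ?nnegrE ?subr_ge0 ?(ltW lam1) ?(ltW T0) //.
by rewrite ler_norml; lra.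
Qed.

Lemma sde_flow_local : small_squares T X ->
  sde_local (fun s => drift s (X s)) sigma z T X.
Proof.
move=> HX; have [n0 H1 H2] := flow_eq.
have [D D0 HD] := lamperti_inv_lip s0_gt0 sigma_ge sigma_lip n0%:R.
pose y t := psi (V n0%:R t + z t).
have Hy : small_squares T y.
  move=> e e0; have [d d0 H] := HX e e0; exists d => // s t s_ge0 st tT td.
  rewrite /y -!H2 ?(le_trans s_ge0 st) ?(le_trans st tT) //; exact: H.
have Hr s : 0 <= s -> s <= T -> rate n0%:R s (V n0%:R s) = drift s (X s) / sigma (y s).
  move=> s_ge0 sT; rewrite /rate /lamperti_rate H2 // -/(y s).
  by have := H1 s s_ge0 sT; rewrite ler_norml => /andP[h1 h2]; rewrite clamp_id.
have sD s : 0 <= s -> s <= T -> sigma (y s) <= D.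
  by move=> s_ge0 sT; have [_ ->] := HD _ _ (H1 s s_ge0 sT) (H1 s s_ge0 sT).
have := sde_local_of_ode s0_gt0 sigma_ge sigma_lip Hy sD Hr
  (truncated_flow_solution (ler0n R n0)).
move=> H e e0; have [d d0 Hd] := H e e0; exists d => // s t s_ge0 st tT td.
rewrite !(H2 t) ?(le_trans s_ge0) // (H2 s) ?(le_trans st) //.
have := Hd s t s_ge0 st tT td.
by rewrite H2 // (le_trans st).
Qed.

Lemma sde_flow_unique y rho : small_squares T y ->
  (forall t, 0 <= t -> t <= T -> `|y t| <= rho) ->
  sde_local (fun s => drift s (y s)) sigma z T y -> y 0 = x0 ->
  forall t, 0 <= t -> t <= T -> X t = y t.
Proof.
move=> Hy yrho Hsol y0; have [n0 H1 H2] := flow_eq.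
have [n1 _ Hn1] := truncated_flow_stable.
pose W t := G (y t) - z t.
have rho0 : 0 <= rho by apply: le_trans (yrho 0 (lexx _) (ltW T0)).
pose m := s0^-1 * rho.
have Gy t : 0 <= t -> t <= T -> `|W t + z t| <= m.
  move=> t0 tT; rewrite subrK.
  have G0 : G 0 = 0 by rewrite /G /lamperti subrr.
  have := lamperti_lip s0_gt0 sigma_ge sigma_lip (y t) 0.
  rewrite -/G G0 !subr0 => /le_trans; apply.
  by rewrite ler_wpM2l ?invr_ge0 ?(ltW s0_gt0) // yrho.
have m0 : 0 <= m by rewrite mulr_ge0 // invr_ge0 ltW.
(* A level at which neither path is truncated: [m] bounds |G(y)|, since G is 1/s0-Lipschitz and
   vanishes at 0. *)
pose M := Num.max n0%:R m.
have M_ge0 : 0 <= M by rewrite le_max ler0n.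
have [K K0 HK] := rate_lip M_ge0.
have HW : ode_solution (rate M) T W.
  apply: (ode_of_sde_local s0_gt0 sigma_ge sigma_lip Hy Hsol) => s s_ge0 sT.
  rewrite /rate /lamperti_rate -/(W s).
  have WM : `|W s + z s| <= M by rewrite le_max Gy // orbT.
  move: WM; rewrite ler_norml => /andP[h1 h2]; rewrite clamp_id // subrK.
  by rewrite (lampertiK s0_gt0 sigma_ge sigma_lip).
have HV : ode_solution (rate M) T (V n0%:R).
  apply: (ode_solution_ext _ _ (truncated_flow_solution (ler0n R n0))) => // s s_ge0 sT.
  have h := H1 s s_ge0 sT; apply: rate_untruncated => //.
  by rewrite le_max h.
move=> t t0 tT; rewrite H2 //.
have -> : V n0%:R t = W t.
  by apply: (ode_solution_unique K0 HK HV HW) => //; rewrite truncated_flow0 /W y0.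
by rewrite subrK; exact: (lampertiK s0_gt0 sigma_ge sigma_lip).
Qed.

End sde_flow.

(** * Coefficients, measurability and function spaces *)

Lemma derive1_bounded_lip (R : realType) (f : R -> R) (M : R) :
  (forall x, derivable f x 1) -> (forall x, `|(f^`())%classic x| <= M) ->
  forall x y, `|f x - f y| <= M * `|x - y|.
Proof.
move=> fd fM x y; wlog yx : x y / y <= x.
  move=> H; case/orP: (le_total y x) => /H //.
  by rewrite distrC [`|y - x|]distrC.
have [c _ ->] : exists2 c, c \in `[y, x] & f x - f y = (f^`())%classic c * (x - y).
  apply: MVT_segment => //; first by move=> u _; rewrite derive1E; exact: derivableP.
  by apply: derivable_within_continuous => u _; exact: fd.
by rewrite normrM ler_wpM2r.
Qed.

Lemma sin_lip (R : realType) (x y : R) : `|sin x - sin y| <= `|x - y|.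
Proof.
rewrite -[leRHS]mul1r; apply: derive1_bounded_lip => u.
- by apply: ex_derive.
- by rewrite derive1E derive_val cos_max.
Qed.

Lemma seasonal_mean_lip (R : realType) (b0 b1 Tper s t : R) : 0 <= b1 -> 0 < Tper ->
  `|seasonal_mean b0 b1 Tper s - seasonal_mean b0 b1 Tper t| <=
  b1 * (2 * pi / Tper) * `|s - t|.
Proof.
move=> b10 T0; rewrite /seasonal_mean.
set x := 2 * pi * s / Tper; set y := 2 * pi * t / Tper.
have -> : b0 + b1 * sin x - (b0 + b1 * sin y) = b1 * (sin x - sin y) by ring.
rewrite normrM (ger0_norm b10) -mulrA ler_wpM2l // (le_trans (sin_lip _ _)) //.
have -> : x - y = 2 * pi / Tper * (s - t) by rewrite /x /y; field; rewrite gt_eqF.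
by rewrite normrM ger0_norm // divr_ge0 ?mulr_ge0 ?pi_ge0 // ltW.
Qed.

Lemma seasonal_mean_itv (R : realType) (b0 b1 Tper t : R) : 0 <= b1 ->
  b0 - b1 <= seasonal_mean b0 b1 Tper t <= b0 + b1.
Proof.
move=> b10; rewrite /seasonal_mean; set x := 2 * pi * t / Tper.
have := sin_geN1 x; have := sin_le1 x; move: (sin x) => u u1 u2.
by apply/andP; split; nra.
Qed.

Lemma C3b_lip (R : realType) (f : R -> R) : C3b f ->
  exists L : R, forall x y, `|f x - f y| <= L * `|x - y|.
Proof.
move=> [fd _ fb]; have [M HM] := fb 1%N isT; exists M.
by apply: derive1_bounded_lip => x; [exact: (fd 0%N x isT)|exact: HM].
Qed.

Lemma diffusion_ge (R : realType) (sigma0 sigma1 : R) (phi : R -> R) (x : R) :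
  0 <= sigma1 -> sigma0 <= diffusion sigma0 sigma1 phi x.
Proof. by move=> s10; rewrite lerDl mulr_ge0 // sqrtr_ge0. Qed.

Lemma lip_continuous (R : realType) (f : R -> R) (K : R) :
  (forall x y, `|f x - f y| <= K * `|x - y|) -> continuous f.
Proof.
move=> fK x; apply/cvgrPdist_le => /= e e0.
have K0 : 0 < `|K| + 1 by rewrite ltr_wpDl.
near=> y.
apply: (@le_trans _ _ ((`|K| + 1) * `|x - y|)).
  by apply: (le_trans (fK _ _)); rewrite ler_wpM2r // (le_trans (ler_norm _)) // lerDl.
rewrite mulrC -ler_pdivlMr // ltW //.
by near: y; exact: (nbhsx_ballx x _ (divr_gt0 e0 K0)).
Unshelve. all: by end_near. Qed.

(** * Measurability of the flow in omega *)

Section measurability.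
Variables (R : realType) (sigma : R -> R) (s0 L : R).
Hypotheses (s0_gt0 : 0 < s0) (sigma_ge : forall x, s0 <= sigma x).
Hypothesis sigma_lip : forall x y, `|sigma x - sigma y| <= L * `|x - y|.
Variables (drift : R -> R -> R) (A beta xm xp : R).
Hypothesis drift_lip : forall s s' x x',
  `|drift s x - drift s' x'| <= A * (`|s - s'| + `|x - x'|).
Hypothesis drift_bounded : forall s, `|drift s 0| <= beta.
Hypothesis drift_le0 : forall s x, xp <= x -> drift s x <= 0.
Hypothesis drift_ge0 : forall s x, x <= xm -> 0 <= drift s x.

Variables (d : measure_display) (O : measurableType d) (z : O -> R -> R).
Hypothesis mz : forall s, measurable_fun setT (z ^~ s).

(** The path enters only through v + z_s, so the rate is a fixed Lipschitz function of one random
    variable. *)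
Lemma measurable_lamperti_rate M s (v : O -> R) : 0 <= M -> measurable_fun setT v ->
  measurable_fun setT (fun w => lamperti_rate sigma drift (z w) M s (v w)).
Proof.
move=> M0 mv.
have [K K0 HK] := lamperti_rate_bounds s0_gt0 sigma_ge sigma_lip drift_lip drift_bounded M0.
pose k u := lamperti_rate sigma drift (fun=> 0) M s u.
have -> : (fun w => lamperti_rate sigma drift (z w) M s (v w)) =
    k \o (fun w => v w + z w s).
  by apply/funext => w; rewrite /k /lamperti_rate /= addr0.
apply: measurableT_comp; last exact: measurable_funD.
apply: continuous_measurable_fun; apply: (@lip_continuous _ _ K) => x y.
by have [_] := HK (fun=> 0) s s x y; rewrite !subrr !normr0 addr0 add0r.
Qed.

Lemma measurable_euler M (v0 : O -> R) h n t : 0 <= M -> measurable_fun setT v0 ->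
  measurable_fun setT
    (fun w => euler (lamperti_rate sigma drift (z w) M) (v0 w) h n t).
Proof.
move=> M0 mv; elim: n t => [//|n IH] t /=.
apply: measurable_funD => //; apply: measurable_funM; first exact: measurable_cst.
exact: measurable_lamperti_rate.
Qed.

Variables (T x0 : R) (zeta : O -> R).
Hypotheses (T0 : 0 < T) (z_bounded : forall w t, `|z w t| <= zeta w).
Hypothesis z_unif : forall w (e : R), 0 < e -> exists2 d : R, 0 < d &
  forall s t, `|s - t| < d -> `|z w s - z w t| <= e.

Lemma measurable_sde_flow t : 0 <= t -> t <= T ->
  measurable_fun setT (fun w => sde_flow sigma drift T x0 (z w) t).
Proof.
move=> t0 tT; rewrite /sde_flow.
have psi_mono : {homo lamperti_inv sigma : u v / u <= v}.
  by move=> u v; rewrite (lamperti_inv_le s0_gt0 sigma_ge sigma_lip).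
apply: (measurableT_comp (nondecreasing_measurable measurableT psi_mono)).
apply: measurable_funD => //.
apply: (@measurable_fun_cvg _ _ _ setT
  (fun n w => truncated_flow sigma drift T x0 (z w) n%:R t)) => [n|w _]; last first.
  exact: (cvg_truncated_flow_nat s0_gt0 sigma_ge sigma_lip drift_lip drift_bounded
    drift_le0 drift_ge0 T0 (z_bounded w) (z_unif w) t0 tT).
apply: (@measurable_fun_cvg _ _ _ setT (fun m w =>
  euler (lamperti_rate sigma drift (z w) n%:R) (lamperti sigma x0 - z w 0)
    (T / m.+1%:R) m.+1 t)) => [m|w _]; last first.
  exact: (cvg_truncated_flow s0_gt0 sigma_ge sigma_lip drift_lip drift_bounded
    T0 (z_unif w) (ler0n R n) t0 tT).
by apply: measurable_euler => //; apply: measurable_funB.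
Qed.

End measurability.

(** * Hoelder functions in the space W_1^alpha *)

Lemma uniformly_continuous_measurable (R : realType) (T t : R) (f : R -> R) :
  0 <= t -> t <= T -> uniformly_continuous_upto T f ->
  measurable_fun (`[0, t]%classic : set (measurableTypeR R)) f.
Proof.
move=> t0 tT Hf; apply/measurable_EFinP.
exact: (measurable_int _ (uniformly_continuous_integrable t0 tT Hf)).
Qed.

(** For p < 1 the integrand is singular at t; stopping at b < t allows the fundamental theorem of
    calculus, and the bound does not depend on b. *)
Lemma integral_powR_lt (R : realType) (C p t b : R) : 0 <= C -> 0 < p -> 0 < b -> b < t ->
  (\int[lebesgue_measure]_(s in `[0%R, b]) (C * (t - s) `^ (p - 1))%:E
    <= (C / p * t `^ p)%:E)%E.
Proof.
move=> C0 p0 b0 bt.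
have dB (s : R) : is_derive s (1 : R) (fun u : R => t - u) (-1 : R).
  have := is_deriveB (is_derive_cst t s 1) (is_derive_id s (1 : R)).
  by rewrite sub0r.
have dF (q s : R) : s < t -> is_derive s (1 : R) (fun u : R => (t - u) `^ q)
      (- (q * (t - s) `^ (q - 1))).
  move=> st; have ts0 : 0 < t - s by rewrite subr_gt0.
  have := @is_derive1_comp _ (@powR R ^~ q) (fun u => t - u) s _ _
    (is_derive1_powR q ts0) (dB s).
  by rewrite mulrN1.
pose F (s : R) : R := - (C / p) * (t - s) `^ p.
have dFF (s : R) : s < t -> is_derive s (1 : R) F (C * (t - s) `^ (p - 1)).
  move=> st; have := @is_deriveZ _ _ _ _ (- (C / p)) _ _ _ (dF p s st).
  rewrite /GRing.scale /=.
  have -> // : - (C / p) * - (p * (t - s) `^ (p - 1)) = C * (t - s) `^ (p - 1).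
  by field; rewrite gt_eqF.
have Fc s : s < t -> {for s, continuous F}.
  by move=> st; apply/differentiable_continuous/derivable1_diffP; have [] := dFF s st.
rewrite (@continuous_FTC2 _ _ F) //.
- rewrite -EFinB lee_fin /F subr0 !mulNr opprK addrC lerBlDr lerDl.
  by rewrite mulr_ge0 ?powR_ge0 // divr_ge0 // ltW.
- apply: derivable_within_continuous => s; rewrite in_itv /= => /andP[_ sb].
  have [] := dF (p - 1) s (le_lt_trans sb bt) => + _.
  by move=> /(@derivableZ _ _ _ _ C).
- split.
  + by move=> s; rewrite in_itv /= => /andP[_ sb]; have [] := dFF s (lt_trans sb bt).
  + by apply: cvg_at_right_filter; apply: Fc; exact: lt_trans bt.
  + by apply: cvg_at_left_filter; exact: Fc.
- move=> s; rewrite in_itv /= => /andP[_ sb]; rewrite derive1E.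
  by have [_ ->] := dFF s (lt_trans sb bt).
Qed.

(** The quotient is at most C (t - s)^(p - 1) with p = lam - alpha > 0, which is integrable up to t;
    monotone convergence over [0, b n] reaches the singular end. *)
Lemma W1_of_holder (R : realType) (lam alpha T : R) (f : R -> R) :
  0 <= T -> 0 < alpha -> alpha < lam -> holder_on lam 0 T f -> W1_space alpha T f.
Proof.
move=> T0 a0 al Hf; have lam0 := lt_trans a0 al.
have fu := holder_uniformly_continuous lam0 Hf.
split; first exact: uniformly_continuous_measurable fu.
have [B B0 HB] := holder_bounded T0 (ltW lam0) Hf.
case: Hf => C' HC'; pose C := `|C'|.
have HC s t : 0 <= s -> s <= t -> t <= T -> `|f t - f s| <= C * (t - s) `^ lam.
  move=> s0 st tT; have := HC' s t.
  rewrite !in_itv /= s0 (le_trans st tT) (le_trans s0 st) tT.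
  move=> /(_ isT isT)/le_trans; apply.
  by rewrite ger0_norm ?subr_ge0 // ler_wpM2r ?powR_ge0 // ler_norm.
pose p := lam - alpha; have p0 : 0 < p by rewrite subr_gt0.
pose K := C / p * T `^ p.
have K0 : 0 <= K by rewrite mulr_ge0 ?powR_ge0 // divr_ge0 ?normr_ge0 // ltW.
apply: (@le_lt_trans _ _ (B + K)%:E); last by rewrite ltry.
apply: ub_ereal_sup => _ [t + <-]; rewrite /= in_itv /= => /andP[t0 tT].
rewrite EFinD; apply: leeD; first by rewrite lee_fin HB.
set g : measurableTypeR R -> \bar R := fun s => (`|f t - f s| / `|t - s| `^ (alpha + 1))%:E.
have g0 s : (0 <= g s)%E by rewrite lee_fin divr_ge0 // powR_ge0.
have mg : measurable_fun (`[0, t]%classic : set (measurableTypeR R)) g.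
  apply/measurable_EFinP.
  have -> : (fun s : measurableTypeR R => `|f t - f s| / `|t - s| `^ (alpha + 1)) =
    (fun s => `|f t - f s| * `|t - s| `^ (- (alpha + 1))).
    by apply/funext => s; rewrite powRN.
  apply: measurable_funM.
    apply: measurableT_comp => //; apply: measurable_funB; first exact: measurable_cst.
    exact: uniformly_continuous_measurable fu.
  apply: (measurableT_comp (measurable_powR _)).
  by apply: measurableT_comp => //; apply: measurable_funB;
    [exact: measurable_cst|exact: measurable_id].
have [->|tn0] := eqVneq t 0.
  by rewrite set_itv1 integral_set1 lee_fin.
have {tn0}t_gt0 : 0 < t by rewrite lt_neqAle eq_sym tn0.
rewrite -integral_itv_bndo_bndc; last first.
  by apply: measurable_funS mg => //; apply: subset_itvl; rewrite bnd_simp.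
(* With n + 2 rather than n + 1, already b 0 is positive. *)
pose b n : R := t - t / n.+2%:R.
have bt n : b n < t by rewrite gtrBl divr_gt0.
have b0 n : 0 < b n by rewrite subr_gt0 ltr_pdivrMr // ltr_pMr // ltr1n.
have -> : (`[0, t[%classic : set (measurableTypeR R)) = \bigcup_n `[0, b n]%classic.
  apply/seteqP; split => s /=; rewrite in_itv /=.
    move=> /andP[s0 st].
    have ts0 : 0 < t - s by rewrite subr_gt0.
    have [n /(_ n.+1 (leqnSn n)) Hn] := exists_fine_mesh t ts0.
    by exists n => //=; rewrite in_itv /= s0 /= /b lerBrDl -lerBrDr ltW.
  by move=> [n _ /=]; rewrite in_itv /= => /andP[-> sb]; rewrite (le_lt_trans sb).
have nd_b : nondecreasing_seq (fun n => `[0, b n]%classic : set (measurableTypeR R)).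
  move=> m n mn; rewrite subsetEset; apply: subset_itvl; rewrite bnd_simp lerD2l lerN2.
  by rewrite ler_wpM2l // lef_pV2 ?posrE // ler_nat.
have mgb n : measurable_fun (`[0, b n]%classic : set (measurableTypeR R)) g.
  by apply: measurable_funS mg => //; apply: subset_itvl; rewrite bnd_simp ltW.
have /cvg_lim <- // := ge0_nondecreasing_set_cvg_integral (mu := lebesgue_measure)
  nd_b (fun n => measurable_itv _) mgb (fun _ s _ => g0 s).
apply: lime_le.
  apply: cvgP; exact: (ge0_nondecreasing_set_cvg_integral (mu := lebesgue_measure)
    nd_b (fun n => measurable_itv _) mgb (fun _ s _ => g0 s)).
apply: nearW => n; apply: (@le_trans _ _ (C / p * t `^ p)%:E); last first.
  rewrite lee_fin ler_wpM2l ?divr_ge0 ?(ltW p0) ?normr_ge0 //.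
  by rewrite ge0_ler_powR ?nnegrE ?(ltW p0).
apply: le_trans (integral_powR_lt (normr_ge0 C') p0 (b0 n) (bt n)).
apply: ge0_le_integral => //.
- apply/measurable_EFinP; apply: measurable_funM; first exact: measurable_cst.
  apply: (measurableT_comp (measurable_powR _)).
  by apply: measurable_funB; [exact: measurable_cst|exact: measurable_id].
- move=> s /=; rewrite in_itv /= => /andP[s0 sb]; have st := le_lt_trans sb (bt n).
  have ts0 : 0 < t - s by rewrite subr_gt0.
  rewrite lee_fin (gtr0_norm ts0) ler_pdivrMr ?powR_gt0 // -mulrA -powRD;
    last by rewrite (gt_eqF ts0) implybT.
  have -> : p - 1 + (alpha + 1) = lam by rewrite /p; ring.
  by apply: HC => //; exact: ltW.
Qed.

(** Recovers the initial value from the equation at t = 0: the empty list partitions [a, a], and its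
    sum is 0. *)
Lemma young_integral_point (R : realType) (f g : R -> R) (a I : R) :
  is_young_integral f g a a I -> I = 0.
Proof.
move=> H; apply/eqP; rewrite -normr_le0; apply/ler_addgt0Pl => e e0; rewrite addr0.
have [d _ /(_ [::] (fun=> a))] := H e e0.
rewrite /riemann_stieltjes_sum big_ord0 sub0r normrN => h.
by apply/ltW/h => //; split.
Qed.

Lemma holder_on_clamp (R : realType) (lam T : R) (f : R -> R) :
  holder_on lam 0 T f -> holder_on lam 0 T (f \o clamp 0 T).
Proof.
move=> [C HC]; exists C => s t sT tT; move: (sT) (tT).
rewrite !in_itv /= => /andP[s1 s2] /andP[t1 t2].
by rewrite !clamp_id //; exact: HC.
Qed.

Lemma uniformly_continuous_drift (R : realType) (drift : R -> R -> R) (A T : R)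
    (y : R -> R) :
  (forall s s' x x', `|drift s x - drift s' x'| <= A * (`|s - s'| + `|x - x'|)) ->
  uniformly_continuous_upto T y ->
  uniformly_continuous_upto T (fun s => drift s (y s)).
Proof.
move=> HA Hy e e0; have c0 : 0 < `|A| + 1 by rewrite ltr_wpDl.
have k0 : 0 < e / 2 / (`|A| + 1) by rewrite !divr_gt0.
have [d d0 H] := Hy _ k0.
exists (Num.min d (e / 2 / (`|A| + 1))); first by rewrite lt_min d0.
move=> s t s0 st tT; rewrite lt_min => /andP[td tk].
have h := H s t s0 st tT td.
apply: (le_trans (HA _ _ _ _)).
apply: (@le_trans _ _ ((`|A| + 1) * (e / 2 / (`|A| + 1) + e / 2 / (`|A| + 1)))).
  apply: (@le_trans _ _ ((`|A| + 1) * (`|t - s| + `|y t - y s|))).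
    by rewrite ler_wpM2r ?addr_ge0 // (le_trans (ler_norm _)) // lerDl.
  rewrite ler_wpM2l ?(ltW c0) // lerD // ger0_norm ?subr_ge0 // ltW //.
by rewrite le_eqVlt; apply/orP; left; apply/eqP; field; rewrite gt_eqF.
Qed.

Lemma sde_local_eq (R : realType) (f sigma z z' y : R -> R) (T : R) :
  (forall s, 0 <= s -> s <= T -> z s = z' s) ->
  sde_local f sigma z T y -> sde_local f sigma z' T y.
Proof.
move=> zz' H e e0; have [d d0 Hd] := H e e0; exists d => // s t s0 st tT td.
by rewrite -!zz' ?(le_trans s0 st) ?(le_trans st tT) //; exact: Hd.
Qed.

Theorem theorem3p3 (R : realType) (P : probability (wiener_space R) R)
  (hP : two_sided_wiener_measure P)
  (q : nat) (hq : (1 <= q)%N) (H : R) (hH : 2^-1 < H) (hH1 : H < 1)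
  (Z : R -> wiener_space R -> R) (hZ : hermite_process P q H Z)
  (a b0 b1 Tper sigma0 sigma1 eps : R)
  (ha : 0 < a) (hb1 : 0 <= b1) (hb0 : `|b1| < b0) (hTper : 0 < Tper)
  (hsigma0 : 0 < sigma0) (hsigma1 : 0 <= sigma1) (heps : 0 < eps)
  (phi : R -> R) (hphi : regularized_positive_part eps phi)
  (hdrift : forall t : R, C3b (fun x => a * (seasonal_mean b0 b1 Tper t - x)))
  (hdiff : C3b (diffusion sigma0 sigma1 phi))
  (T x0 : R) (hT : 0 < T) (hx0 : 0 < x0)
  (hL : exists2 C : R, 0 < C &
    forall s t : R, s \in `[0, T] -> t \in `[0, T] ->
      (Lnorm (lebesgue_tuple R q) 2%:E
         (EFin \o (@hermite_kernel R q H t \- @hermite_kernel R q H s)%R)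
       <= (C * `|t - s| `^ H)%:E)%E) :
  let drift (t x : R) := a * (seasonal_mean b0 b1 Tper t - x) in
  let sigma := diffusion sigma0 sigma1 phi in
  exists X : R -> wiener_space R -> R,
    [/\ is_solution P Z drift sigma T x0 X,
        {ae P, forall w, forall alpha : R, 1 - H < alpha -> alpha < 2^-1 ->
           W1_space alpha T (X ^~ w) /\ holder_space (1 - alpha) T (X ^~ w)} &
        forall (Y : R -> wiener_space R -> R) (alpha : R),
          1 - H < alpha -> alpha < 2^-1 ->
          is_solution P Z drift sigma T x0 Y ->
          {ae P, forall w, W1_space alpha T (Y ^~ w) /\
                           holder_space (1 - alpha) T (Y ^~ w)} ->
          {ae P, forall w, forall t : R, t \in `[0, T] -> X t w = Y t w}].
Proof.
move=> drift sigma.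
have [L sigma_lip] := C3b_lip hdiff.
have sigma_ge x : sigma0 <= sigma x by exact: diffusion_ge.
have a0 := ltW ha.
pose Lb := b1 * (2 * pi / Tper).
have Lb0 : 0 <= Lb by rewrite !mulr_ge0 ?pi_ge0 // invr_ge0 ltW.
have drift_lip s s' x x' :
    `|drift s x - drift s' x'| <= a * (Lb + 1) * (`|s - s'| + `|x - x'|).
  rewrite /drift -mulrBr normrM (ger0_norm a0) -mulrA ler_wpM2l //.
  set b := seasonal_mean b0 b1 Tper.
  have -> : b s - x - (b s' - x') = (b s - b s') - (x - x') by ring.
  apply: (le_trans (ler_normB _ _)).
  have := seasonal_mean_lip b0 s s' hb1 hTper; rewrite -/b -/Lb.
  have : 0 <= Lb * `|x - x'| by rewrite mulr_ge0.
  by have := normr_ge0 (s - s'); lra.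
have drift_bounded s : `|drift s 0| <= a * (b0 + b1).
  rewrite /drift subr0 normrM (ger0_norm a0) ler_wpM2l //.
  have /andP[h1 h2] := seasonal_mean_itv b0 Tper s hb1.
  by move: hb0; rewrite (ger0_norm hb1) ler_norml => h; apply/andP; split; lra.
(* The seasonal mean stays in [b0 - b1, b0 + b1]; outside this interval the drift points back to
   it. *)
have drift_le0 s x : b0 + b1 <= x -> drift s x <= 0.
  move=> bx; rewrite /drift mulr_ge0_le0 // subr_le0.
  by have /andP[_ h] := seasonal_mean_itv b0 Tper s hb1; exact: le_trans h bx.
have drift_ge0 s x : x <= b0 - b1 -> 0 <= drift s x.
  move=> bx; rewrite /drift mulr_ge0 // subr_ge0.
  by have /andP[h _] := seasonal_mean_itv b0 Tper s hb1; exact: le_trans bx h.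
have [hZm hZh] := hZ.
have T0 := ltW hT.
(* [Z] is controlled at nonnegative times only; freezing it outside [0, T] makes every path bounded
   and uniformly continuous on the whole line, and measurable at each time. *)
pose z w : R -> R := (Z ^~ w) \o clamp 0 T.
have zE w s : 0 <= s -> s <= T -> z w s = Z s w.
  by move=> s0 sT; rewrite /z /= clamp_id.
(* Any exponent strictly between 1/2 and H would do: below H for the regularity of [Z], above 1/2
   for small squares. *)
pose lam := (H + 2^-1) / 2.
have lam2 : 2^-1 < lam by rewrite /lam; lra.
have lamH : lam < H by rewrite /lam; lra.
have lam0 : 0 < lam by lra.
have Z_holder w : holder_on lam 0 T (Z ^~ w) by exact: hZh.
have z_holder w l : 0 < l -> l < H -> holder_on l 0 T (z w).
  by move=> l0 lH; apply: holder_on_clamp; exact: hZh.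
(* A choice made by [cid], because the measurability lemma takes the bound as a function of the
   path. *)
have z_bounded w : {zeta : R | forall t, `|z w t| <= zeta}.
  apply: cid; have [B _ HB] := holder_bounded T0 (ltW lam0) (Z_holder w).
  by exists B => t; have /andP[c1 c2] := clamp_itv t T0; exact: HB.
have z_unif w (e : R) : 0 < e -> exists2 d : R, 0 < d &
    forall s t, `|s - t| < d -> `|z w s - z w t| <= e.
  move=> e0; have Zu := holder_uniformly_continuous lam0 (Z_holder w).
  exact: (uniformly_continuous_clamp T0 Zu e0).
have mz s : measurable_fun [set: wiener_space R] (z ^~ s).
  by have /andP[c1 _] := clamp_itv s T0; have [] := hZm _ c1.
pose X t w := sde_flow sigma drift T x0 (z w) t.
have X_holder w l : 0 < l -> l < H -> holder_on l 0 T (X ^~ w).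
  move=> l0 lH; apply: (sde_flow_holder hsigma0 sigma_ge sigma_lip drift_lip
    drift_bounded drift_le0 drift_ge0 x0 hT (svalP (z_bounded w)) (z_unif w)) => //.
  - exact: lt_trans hH1.
  - exact: z_holder.
have X_small w : small_squares T (X ^~ w).
  exact: (holder_small_squares lam2 (X_holder w lam lam0 lamH)).
have X0 w : X 0 w = x0.
  exact: (sde_flow0 hsigma0 sigma_ge sigma_lip drift_lip drift_bounded
    drift_le0 drift_ge0 x0 hT (svalP (z_bounded w)) (z_unif w)).
exists X; split.
- split=> [t|].
    rewrite in_itv /= => /andP[t0 tT].
    exact: (measurable_sde_flow hsigma0 sigma_ge sigma_lip drift_lip drift_bounded
      drift_le0 drift_ge0 mz x0 hT (fun w => svalP (z_bounded w)) z_unif t0 tT).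
  apply: aeW => w t; rewrite in_itv /= => /andP[t0 tT].
  have fu := uniformly_continuous_drift drift_lip (small_squares_unif (X_small w)).
  split; first exact: (uniformly_continuous_integrable t0 tT fu).
  exists (X t w - X 0 w - \int[lebesgue_measure]_(s in `[0, t]) drift s (X s w)).
    have L0 : 0 <= L.
      by have := sigma_lip 1 0; rewrite subr0 normr1 mulr1; exact: le_trans.
    apply: (young_of_sde_local L0 sigma_lip (X_small w) _ fu _ t0 tT).
      exact: (holder_small_squares lam2 (Z_holder w)).
    apply: (sde_local_eq (zE w)).
    exact: (sde_flow_local hsigma0 sigma_ge sigma_lip drift_lip drift_bounded
      drift_le0 drift_ge0 hT (svalP (z_bounded w)) (z_unif w) (X_small w)).
  by rewrite X0; ring.
- apply: aeW => w alpha aH a2.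
  (* alpha > 1 - H puts 1 - alpha below H, and alpha < 1/2 gives alpha < 1 - alpha, as membership in
     W_1^alpha requires. *)
  have X_h : holder_on (1 - alpha) 0 T (X ^~ w) by apply: X_holder; lra.
  split=> //; apply: (W1_of_holder T0 _ _ X_h); lra.
- move=> Y alpha aH a2 [_ Ysol]; apply: filterS2 Ysol => w Yw [_ Yh] t.
  rewrite in_itv /= => /andP[t0 tT].
  have Y_small : small_squares T (Y ^~ w).
    by apply: (holder_small_squares _ Yh); lra.
  have Y0 : Y 0 w = x0.
    have [_ [I HI ->]] := Yw 0 (ltac:(by rewrite in_itv /= lexx T0)).
    by rewrite (young_integral_point HI) set_itv1 Rintegral_set1 !addr0.
  have [rho _ Hrho] : exists2 rho : R, 0 <= rho &
      forall t, 0 <= t -> t <= T -> `|Y t w| <= rho.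
    by apply: (holder_bounded T0 _ Yh); lra.
  apply: (sde_flow_unique hsigma0 sigma_ge sigma_lip drift_lip drift_bounded
    drift_le0 drift_ge0 hT (svalP (z_bounded w)) (z_unif w) Y_small Hrho _ Y0 t0 tT).
  apply: (@sde_local_eq _ _ _ (Z ^~ w)) => [s s0 sT|]; first by rewrite zE.
  have L0 : 0 <= L.
    by have := sigma_lip 1 0; rewrite subr0 normr1 mulr1; exact: le_trans.
  (* Both exponents, 1 - alpha for Y and lam for Z, exceed 1/2, so their sum exceeds 1. *)
  apply: (sde_local_of_young _ L0 sigma_lip Yh (Z_holder w)) => [||u u0 uT].
  + by lra.
  + exact: (uniformly_continuous_drift drift_lip (small_squares_unif Y_small)).
  + have [_ [I HI YI]] := Yw u (ltac:(by rewrite in_itv /= u0 uT)).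
    exact: (ex_intro2 _ _ I HI YI).
Qed.
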